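(* Let $k$ be a field and let $G$ be a pendant cliques graph on the vertex set $[n]=\{1,\dots,n\}$, with binomial edge ideal $J_G\subseteq S=k[x_1,\dots,x_n,y_1,\dots,y_n]$. Then $J_G^{t}=J_G^{(t)}$ for every integer $t\ge 1$, where $J_G^{(t)}$ denotes the $t$-th symbolic power of $J_G$.
   Context: All graphs are finite and simple. Clique join via a vertex: for a graph $H$, a vertex $v\in V(H)$ and $t\ge 2$, the clique join $H\sqcup_v K_t$ is the graph obtained from $H$ by adding $t-1$ new vertices $u_1,\dots,u_{t-1}$, all edges $\{u_i,v\}$ for $1\le i\le t-1$, and all edges $\{u_i,u_j\}$ for $1\le i<j\le t-1$. Pendant cliques graph: a graph obtained from a path $P$ by performing in succession clique joins of some complete graphs $K_{t_1},\dots,K_{t_m}$ via pairwise distinct vertices $v_1,\dots,v_m$ of $P$. Binomial edge ideal: for a graph $G$ on $[n]$, $J_G$ is the ideal of $S=k[x_1,\dots,x_n,y_1,\dots,y_n]$ generated by the binomials $f_{i,j}=x_iy_j-y_ix_j$ with $\{i,j\}\in E(G)$. Symbolic power: if $I$ is an ideal of a Noetherian ring with minimal primes $\mathfrak p_1,\dots,\mathfrak p_r$, then $I^{(m)}=\mathfrak q_1\cap\dots\cap\mathfrak q_r$, where $\mathfrak q_i$ is the $\mathfrak p_i$-primary component of $I^m$. *)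

(* Defs.v *)
From mathcomp Require Import all_boot all_order all_algebra.
From mathcomp Require Import mpoly.
From mathcomp Require Import boolp classical_sets.

Set Implicit Arguments.
Unset Strict Implicit.
Unset Printing Implicit Defensive.

Import GRing.Theory.
Local Open Scope ring_scope.
Local Open Scope classical_set_scope.

Record simple_graph (T : finType) := SimpleGraph {
  adj :> rel T;
  adj_sym : ssrbool.symmetric adj;
  adj_irr : irreflexive adj
}.

Section Graphs.

Definition path_adj (p : nat) : rel 'I_p :=
  fun i j => (i.+1 == j :> nat) || (j.+1 == i :> nat).

Lemma path_adj_sym p : ssrbool.symmetric (@path_adj p).
Proof. by move=> i j; rewrite /path_adj orbC. Qed.

Lemma path_adj_irr p : irreflexive (@path_adj p).
Proof. by move=> i; rewrite /path_adj gtn_eqF. Qed.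

Definition path_graph (p : nat) : simple_graph 'I_p :=
  SimpleGraph (@path_adj_sym p) (@path_adj_irr p).

Variables (T : finType) (H : simple_graph T) (v : T) (t : nat).

Definition clique_join_adj : rel (T + 'I_t.-1)%type := fun a b =>
  match a, b with
  | inl x, inl y => H x y
  | inl x, inr _ => x == v
  | inr _, inl y => y == v
  | inr i, inr j => i != j
  end.

Lemma clique_join_adj_sym : ssrbool.symmetric clique_join_adj.
Proof. by move=> [x|i] [y|j] //=; [exact: adj_sym | rewrite eq_sym]. Qed.

Lemma clique_join_adj_irr : irreflexive clique_join_adj.
Proof. by move=> [x|i] /=; [exact: adj_irr | rewrite eqxx]. Qed.

Definition clique_join : simple_graph (T + 'I_t.-1)%type :=
  SimpleGraph clique_join_adj_sym clique_join_adj_irr.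

End Graphs.

Definition graph_iso (T U : finType) (G : simple_graph T)
    (H : simple_graph U) : Prop :=
  exists2 h : T -> U, bijective h & forall x y, H (h x) (h y) = G x y.

(* [iota] embeds the vertices of the path into the current graph, and [vs]
   lists the path vertices at which a clique has already been joined. *)
Inductive path_clique_joins (p : nat) :
    forall T : finType, simple_graph T -> ('I_p -> T) -> seq 'I_p -> Prop :=
| PathCliqueJoins0 : path_clique_joins (path_graph p) id [::]
| PathCliqueJoinsS (T : finType) (H : simple_graph T) (iota : 'I_p -> T)
    (vs : seq 'I_p) (v : 'I_p) (t : nat) :
    path_clique_joins H iota vs -> v \notin vs -> (2 <= t)%N ->
    path_clique_joins (clique_join H (iota v) t)
      (fun i => inl (iota i)) (v :: vs).

Definition pendant_cliques (U : finType) (G : simple_graph U) : Prop :=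
  exists (p : nat) (T : finType) (H : simple_graph T) (iota : 'I_p -> T)
    (vs : seq 'I_p),
    [/\ (0 < p)%N, path_clique_joins H iota vs & graph_iso H G].

Section Ideals.

Variable R : comNzRingType.
Implicit Types I J P Q A : set R.

(* Unlike [idealr_closed], this allows the unit ideal. *)
Definition is_ideal I : Prop :=
  [/\ I 0, forall a b, I a -> I b -> I (a + b)
    & forall r a, I a -> I (r * a)].

Definition ideal_gen A : set R := smallest is_ideal A.

Definition ideal_mul I J : set R :=
  ideal_gen [set c | exists a b, [/\ I a, J b & c = a * b]].

Fixpoint ideal_pow I (m : nat) : set R :=
  if m is m'.+1 then ideal_mul (ideal_pow I m') I else setT.

Definition radical I : set R := [set a | exists m : nat, I (a ^+ m)].

Definition is_prime P : Prop :=
  [/\ is_ideal P, ~ P 1 & forall a b, P (a * b) -> P a \/ P b].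

Definition is_primary Q : Prop :=
  [/\ is_ideal Q, ~ Q 1 & forall a b, Q (a * b) -> Q a \/ radical Q b].

Definition minimal_prime I P : Prop :=
  [/\ is_prime P, I `<=` P
    & forall P', is_prime P' -> I `<=` P' -> P' `<=` P -> P' = P].

Definition minimal_primary_decomposition I (r : nat) (Q : 'I_r -> set R) :
    Prop :=
  [/\ forall i, is_primary (Q i),
      I = \bigcap_(i in [set: 'I_r]) Q i,
      injective (fun i => radical (Q i))
    & forall i, ~ (\bigcap_(j in [set j | j != i]) Q j `<=` Q i)].

Definition primary_component I P Q : Prop :=
  exists (r : nat) (D : 'I_r -> set R) (i : 'I_r),
    [/\ minimal_primary_decomposition I D, D i = Q & radical Q = P].

(* For R Noetherian and P a minimal prime of I, the P-primary component of
   I^m exists and is unique when m > 0 (P is then also minimal over I^m), so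
   exactly one Q is contributed to the intersection by each P. *)
Definition symbolic_power I (m : nat) : set R :=
  \bigcap_(Q in [set Q | exists2 P, minimal_prime I P
                                  & primary_component (ideal_pow I m) P Q]) Q.

End Ideals.

Section BinomialEdgeIdeal.

Variables (k : fieldType) (n : nat).

(* The first n variables are the x_i, the last n are the y_i. *)
Definition xvar (i : 'I_n) : {mpoly k[n + n]} := 'X_(lshift n i).
Definition yvar (i : 'I_n) : {mpoly k[n + n]} := 'X_(rshift n i).

Definition edge_binomial (i j : 'I_n) : {mpoly k[n + n]} :=
  xvar i * yvar j - yvar i * xvar j.

Definition binomial_edge_ideal (G : simple_graph 'I_n) :
    set {mpoly k[n + n]} :=
  ideal_gen [set f | exists i j, G i j /\ f = edge_binomial i j].

End BinomialEdgeIdeal.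

Arguments binomial_edge_ideal k [n] G _.

(* Main.v *)
Require Import Defs.
From mathcomp Require Import all_boot all_order all_algebra.
From mathcomp Require Import mpoly.
From mathcomp Require Import boolp classical_sets zify ring.

Set Implicit Arguments.
Unset Strict Implicit.
Unset Printing Implicit Defensive.

Import GRing.Theory.

(** The powers of J = J_G are computed by a Groebner-type argument, the "initial
    term" of a polynomial being its part of lowest weight, where the a-th x has
    weight [ord a] for an ordering [ord] of the vertices and the y's have
    weight 0.

    A set C of variables is a cover if it meets the initial terms of all binomials
    attached to paths of G. For a minimal cover C, let the vertices outside
    S = {a | x_a, y_a in C} be alive: every component of alive vertices contains
    exactly one pivot, a vertex with neither variable in C. The substitution
    x_a |-> [x_a in C] x_a + lambda_a x_T, y_a |-> [y_a in C] y_a + lambda_a y_T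
    (T the pivot of the component of a, the second terms being absent for a in S)
    moves a generic point of the variety of S in the directions of C. The
    polynomials sent by it to (C)^t form a primary ideal Q_C containing J^t, whose
    radical is a minimal prime of J. Moreover, if f is in Q_C, then every monomial
    of lowest weight of f has C-degree at least t.

    Hence J^t is the intersection of the Q_C as soon as every monomial m is
    divisible by a product of min_C deg_C m initial terms of elements of J: one
    can then subtract elements of J^t from f to raise its weight. For pendant
    cliques graphs this max-flow-min-cut property is proved by dynamic programming
    along the path, a greedy matching being used inside each clique. *)

(** * Weights and lowest forms *)

Section Weights.
Local Open Scope ring_scope.

Variables (k : fieldType) (N : nat).
Implicit Types (w : 'I_N -> nat) (m : 'X_{1..N}) (f g : {mpoly k[N]}).

Definition mwt w m : nat := (\sum_i w i * m i)%N.

Lemma mwtD w m1 m2 : mwt w (m1 + m2)%MM = (mwt w m1 + mwt w m2)%N.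
Proof.
by rewrite /mwt -big_split; apply: eq_bigr => i _; rewrite mnmDE mulnDr.
Qed.

Lemma mwt0 w : mwt w 0%MM = 0%N.
Proof. by rewrite /mwt big1 // => i _; rewrite mnm0E muln0. Qed.

Lemma mwtU w i : mwt w U_(i)%MM = w i.
Proof.
rewrite /mwt (bigD1 i) //= mnm1E eqxx muln1 big1 ?addn0 // => j ji.
by rewrite mnm1E eq_sym (negbTE ji) muln0.
Qed.

Lemma mwtMn w m e : mwt w (m *+ e)%MM = (mwt w m * e)%N.
Proof.
elim: e => [|e IH]; first by rewrite mulm0n mwt0 muln0.
by rewrite mulmS mwtD IH mulnS.
Qed.

(** For a 0/1 weight marking a set of variables, this is membership in the [d]-th power of the ideal
    they generate. *)
Definition wfil w d f : bool := all (fun m => d <= mwt w m)%N (msupp f).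

Lemma wfilP w d f :
  reflect (forall m, f@_m != 0 -> (d <= mwt w m)%N) (wfil w d f).
Proof.
apply: (iffP allP) => h m hm; apply: h.
  by rewrite mcoeff_msupp.
by rewrite -mcoeff_msupp.
Qed.

Lemma wfilPn w d f : wfil w d f -> forall m, (mwt w m < d)%N -> f@_m = 0.
Proof.
move=> /wfilP h m lt; apply/eqP/negPn/negP => /h.
by rewrite leqNgt lt.
Qed.

Lemma wfil_leq w d e f : (e <= d)%N -> wfil w d f -> wfil w e f.
Proof. by move=> le /wfilP h; apply/wfilP => m /h; apply: leq_trans. Qed.

Lemma wfil_zero w d : wfil w d 0.
Proof. by rewrite /wfil msupp0. Qed.

Lemma wfil0n w f : wfil w 0 f.
Proof. exact/wfilP. Qed.

Lemma wfilD w d f g : wfil w d f -> wfil w d g -> wfil w d (f + g).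
Proof.
move=> hf hg; apply/wfilP => m; apply: contraNT; rewrite -ltnNge => lt.
by rewrite mcoeffD (wfilPn hf lt) (wfilPn hg lt) addr0.
Qed.

Lemma wfilN w d f : wfil w d f -> wfil w d (- f).
Proof.
move=> hf; apply/wfilP => m; apply: contraNT; rewrite -ltnNge => lt.
by rewrite mcoeffN (wfilPn hf lt) oppr0.
Qed.

Lemma wfilB w d f g : wfil w d f -> wfil w d g -> wfil w d (f - g).
Proof. by move=> hf hg; apply/wfilD/wfilN. Qed.

Lemma wfilZ w d c f : wfil w d f -> wfil w d (c *: f).
Proof.
move=> hf; apply/wfilP => m; apply: contraNT; rewrite -ltnNge => lt.
by rewrite mcoeffZ (wfilPn hf lt) mulr0.
Qed.

Lemma wfil_sum w d (I : Type) (s : seq I) (P : pred I) (F : I -> {mpoly k[N]}) :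
  (forall i, P i -> wfil w d (F i)) -> wfil w d (\sum_(i <- s | P i) F i).
Proof.
move=> h; apply: (big_ind (fun f => wfil w d f)) => //; first exact: wfil_zero.
by move=> f g; apply: wfilD.
Qed.

Lemma wfilM w d e f g : wfil w d f -> wfil w e g -> wfil w (d + e) (f * g).
Proof.
move=> /allP hf /allP hg; apply/allP => m /msuppM_le /allpairsP [[m1 m2] /= [h1 h2 ->]].
by rewrite mwtD leq_add ?hf ?hg.
Qed.

Lemma wfilMl w d f g : wfil w d g -> wfil w d (f * g).
Proof. by move=> h; rewrite -[d]add0n; apply: wfilM h; apply: wfil0n. Qed.

Lemma wfilMr w d f g : wfil w d f -> wfil w d (f * g).
Proof. by rewrite mulrC; apply: wfilMl. Qed.

Lemma wfilX w m : wfil w (mwt w m) 'X_[m].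
Proof. by rewrite /wfil msuppX /= leqnn. Qed.

Lemma wfil_ideal w d : is_ideal [set f | wfil w d f].
Proof.
split=> /=; [exact: wfil_zero | by move=> a b; apply: wfilD |].
by move=> r a; apply: wfilMl.
Qed.

Definition wpart w d f : {mpoly k[N]} :=
  \sum_(m <- msupp f) (if mwt w m == d then f@_m else 0) *: 'X_[m].

Lemma mcoeff_wpart w d f m :
  (wpart w d f)@_m = if mwt w m == d then f@_m else 0.
Proof.
rewrite /wpart raddf_sum /=.
under eq_bigr do rewrite mcoeffZ mcoeffX.
have [ms|mns] := boolP (m \in msupp f).
  rewrite (bigD1_seq m) ?msupp_uniq //= eqxx mulr1 big1 ?addr0 // => m'.
  by move=> /negbTE ->; exact: mulr0.
rewrite big_seq big1; first by rewrite (memN_msupp_eq0 mns) if_same.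
move=> m' m's; case: (m' =P m) => [mm'|]; last by move=> _; exact: mulr0.
by rewrite mm' (negbTE mns) in m's.
Qed.

Lemma wfil_subpart w d f : wfil w d f -> wfil w d.+1 (f - wpart w d f).
Proof.
move=> hf; apply/wfilP => m; apply: contraNT; rewrite -leqNgt => le.
rewrite mcoeffB mcoeff_wpart; case: (mwt w m =P d) => [_|ne]; first by rewrite subrr.
by rewrite (wfilPn hf) ?subrr // ltn_neqAle le andbT; apply/eqP.
Qed.

Lemma msupp_wpart w d f m : m \in msupp (wpart w d f) -> mwt w m = d.
Proof. by rewrite mcoeff_msupp mcoeff_wpart; case: (mwt w m =P d) => // _; rewrite eqxx. Qed.

Lemma wfil_part w d f : wfil w d (wpart w d f).
Proof. by apply/allP => m /msupp_wpart ->. Qed.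

(** The product of the two lowest parts is the part of weight [d + e] of [f * g], which vanishes,
    and the polynomial ring is a domain. *)
Lemma wpart_mul_eq0 w d e f g : wfil w d f -> wfil w e g ->
  wfil w (d + e).+1 (f * g) -> (wpart w d f == 0) || (wpart w e g == 0).
Proof.
move=> hf hg hfg; rewrite -mulf_eq0; apply/eqP/mpolyP => m; rewrite mcoeff0.
have hp : wfil w (d + e).+1 (wpart w d f * wpart w e g).
  have -> : wpart w d f * wpart w e g =
      f * g - (f - wpart w d f) * g - wpart w d f * (g - wpart w e g) by ring.
  apply: wfilB; first apply: wfilB hfg _.
    by rewrite -addSn; apply: wfilM hg; apply: wfil_subpart.
  by rewrite -addnS; apply: wfilM (wfil_part _ _ _) _; apply: wfil_subpart.
have [ms|/memN_msupp_eq0 //] := boolP (m \in msupp (wpart w d f * wpart w e g)).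
move/allP: hp => /(_ m ms).
have /allpairsP [[m1 m2] /= [/msupp_wpart h1 /msupp_wpart h2 ->]] := msuppM_le ms.
by rewrite mwtD h1 h2 ltnn.
Qed.

(** A nonzero part of weight 0 in [g] forces the parts of [f] of weight below [t] to vanish one
    after another. In particular, powers of an ideal generated by variables are primary. *)
Lemma wfil_primary w t f g : wfil w t (f * g) -> wfil w t f \/ wfil w 1 g.
Proof.
move=> hfg; have [hg|hg] := boolP (wfil w 1 g); [by right | left].
have g0 : wpart w 0 g != 0.
  apply: contraNneq hg => g0.
  by have := wfil_subpart (wfil0n w g); rewrite g0 subr0.
suff h : forall s, (s <= t)%N -> wfil w s f by exact: h.
elim=> [_|s IH st]; first exact: wfil0n.
have hs := IH (ltnW st).
have := wpart_mul_eq0 hs (wfil0n w g).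
rewrite addn0 (negbTE g0) orbF => /(_ (wfil_leq st hfg)) /eqP f0.
by have := wfil_subpart hs; rewrite f0 subr0.
Qed.

Definition lowform w f m : bool := wfil w (mwt w m).+1 (f - 'X_[m]).

Lemma lowform_wfil w f m : lowform w f m -> wfil w (mwt w m) f.
Proof.
by move=> h; rewrite -[f](subrK 'X_[m]); apply: wfilD (wfilX _ _); apply: wfil_leq h.
Qed.

Lemma lowformX w m : lowform w 'X_[m] m.
Proof. by rewrite /lowform subrr wfil_zero. Qed.

Lemma lowformM w f g m1 m2 :
  lowform w f m1 -> lowform w g m2 -> lowform w (f * g) (m1 + m2)%MM.
Proof.
move=> hf hg; rewrite /lowform mpolyXD mwtD.
have -> : f * g - 'X_[m1] * 'X_[m2] =
    (f - 'X_[m1]) * g + 'X_[m1] * (g - 'X_[m2]) by ring.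
apply: wfilD; first by rewrite -addSn; apply: wfilM (lowform_wfil hg).
by rewrite -addnS; apply: wfilM (wfilX _ _) hg.
Qed.

Lemma lowform1 w : lowform w 1 0%MM.
Proof. by rewrite -mpolyX0 lowformX. Qed.

Lemma lowform_exp w f m e : lowform w f m -> lowform w (f ^+ e) (m *+ e)%MM.
Proof.
move=> h; elim: e => [|e IH]; first by rewrite expr0 mulm0n lowform1.
by rewrite exprS mulmS lowformM.
Qed.

Lemma lowform_prod w (I : Type) (s : seq I) (F : I -> {mpoly k[N]})
    (G : I -> 'X_{1..N}) : (forall i, lowform w (F i) (G i)) ->
  lowform w (\prod_(i <- s) F i) (\sum_(i <- s) G i)%MM.
Proof.
move=> h; elim: s => [|i s IH]; first by rewrite !big_nil lowform1.
by rewrite !big_cons lowformM.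
Qed.

Lemma lowform_coef w f m m' : lowform w f m -> (mwt w m' <= mwt w m)%N ->
  f@_m' = (m == m')%:R.
Proof.
move=> h le; rewrite -[f](subrK 'X_[m]) mcoeffD (wfilPn h) ?ltnS //.
by rewrite add0r mcoeffX.
Qed.

End Weights.

(** * Powers and symbolic powers of ideals *)

Section IdealPowers.
Local Open Scope ring_scope.
Local Open Scope classical_set_scope.

Variable R : comNzRingType.
Implicit Types I J P Q A : set R.

Lemma is_ideal_sum I (T : Type) (s : seq T) (p : pred T) (F : T -> R) :
  is_ideal I -> (forall i, p i -> I (F i)) -> I (\sum_(i <- s | p i) F i).
Proof.
by case=> I0 ID _ IF; apply: (big_ind I).
Qed.

Lemma is_idealB I a b : is_ideal I -> I a -> I b -> I (a - b).
Proof. by case=> _ ID IM Ia Ib; rewrite -mulN1r; apply/ID/IM. Qed.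

Lemma is_idealX I a m1 m2 : is_ideal I -> (m1 <= m2)%N -> I (a ^+ m1) -> I (a ^+ m2).
Proof. by case=> _ _ IM le Ia; rewrite -(subnK le) exprD; apply: IM. Qed.

Lemma is_ideal_setT : is_ideal [set: R].
Proof. by split. Qed.

Lemma is_ideal_bigcap (T : Type) (D : set T) (F : T -> set R) :
  (forall i, D i -> is_ideal (F i)) -> is_ideal (\bigcap_(i in D) F i).
Proof.
move=> h; split.
- by move=> i /h [].
- by move=> a b Fa Fb i Di; case: (h i Di) => _ ID _; apply: ID; [apply: Fa | apply: Fb].
- by move=> r a Fa i Di; case: (h i Di) => _ _ IM; apply/IM/Fa.
Qed.

Lemma ideal_gen_is_ideal A : is_ideal (ideal_gen A).
Proof. by apply: is_ideal_bigcap => I []. Qed.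

Lemma ideal_gen_sub A I : is_ideal I -> A `<=` I -> ideal_gen A `<=` I.
Proof. by move=> hI hA; apply: smallest_sub. Qed.

Lemma mem_ideal_gen A a : A a -> ideal_gen A a.
Proof. exact: sub_gen_smallest. Qed.

Lemma ideal_pow_is_ideal I m : is_ideal (ideal_pow I m).
Proof. by case: m => [|m]; [exact: is_ideal_setT | exact: ideal_gen_is_ideal]. Qed.

Lemma ideal_powS_mul I m a b : ideal_pow I m a -> I b -> ideal_pow I m.+1 (a * b).
Proof. by move=> ha hb; apply: mem_ideal_gen; exists a, b. Qed.

Lemma ideal_powD_mul I m1 m2 a b :
  ideal_pow I m1 a -> ideal_pow I m2 b -> ideal_pow I (m1 + m2) (a * b).
Proof.
move=> ha; elim: m2 b => [|m2 IH] b hb.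
  by rewrite addn0 mulrC; case: (ideal_pow_is_ideal I m1) => _ _; apply.
have [K0 KD KM] := ideal_pow_is_ideal I (m1 + m2.+1).
have hK : is_ideal [set b | ideal_pow I (m1 + m2.+1) (a * b)].
  split=> /= [|c d hc hd|r c hc]; first by rewrite mulr0.
    by rewrite mulrDr; apply: KD.
  by rewrite mulrCA; apply: KM.
apply: (ideal_gen_sub hK _ hb) => _ [c [d [hc hd ->]]] /=.
by rewrite mulrA addnS; apply: ideal_powS_mul => //; apply: IH.
Qed.

Lemma ideal_pow_leq I m1 m2 : (m1 <= m2)%N -> ideal_pow I m2 `<=` ideal_pow I m1.
Proof.
have hS m : ideal_pow I m.+1 `<=` ideal_pow I m.
  apply: ideal_gen_sub (ideal_pow_is_ideal I m) _ => _ [a [b [ha _ ->]]].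
  by rewrite mulrC; case: (ideal_pow_is_ideal I m) => _ _; apply.
move=> /subnK <-; elim: (m2 - m1)%N => [|m IH]; [by rewrite add0n | apply: subset_trans IH].
by rewrite addSn; apply: hS.
Qed.

Lemma ideal_pow1 I : I `<=` ideal_pow I 1.
Proof. by move=> a Ia; rewrite -[a]mul1r; apply: ideal_powS_mul. Qed.

Lemma ideal_pow_filtration I (F : nat -> set R) : (forall m, is_ideal (F m)) ->
  F 0%N = setT -> (forall m a b, F m a -> I b -> F m.+1 (a * b)) ->
  forall m, ideal_pow I m `<=` F m.
Proof.
move=> hF F0 FS; elim=> [|m IH] /=; first by rewrite F0.
by apply: ideal_gen_sub => // _ [a [b [/IH ha hb ->]]]; apply: FS.
Qed.

Lemma primeX P a m : is_prime P -> P (a ^+ m) -> P a.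
Proof.
case=> _ P1 PM; elim: m => [|m IH]; first by rewrite expr0.
by rewrite exprS => /PM [].
Qed.

Lemma prime_prod P (T : Type) (s : seq T) (p : pred T) (F : T -> R) : is_prime P ->
  (forall i, p i -> ~ P (F i)) -> ~ P (\prod_(i <- s | p i) F i).
Proof.
move=> [_ P1 PM] hF; apply: (big_ind (fun a => ~ P a)) => // a b ha hb.
by move=> /PM [].
Qed.

Lemma is_ideal_prod I (T : finType) (p : pred T) (F : T -> R) (i : T) :
  is_ideal I -> p i -> I (F i) -> I (\prod_(j | p j) F j).
Proof. by case=> _ _ IM pi IF; rewrite (bigD1 i) //= mulrC; apply: IM. Qed.

(* Components with the same radical are merged; irredundancy holds because the
   radicals, being minimal over [I], are pairwise incomparable. *)
Lemma ideal_pow_eq_symbolic I t (T : finType) (Q : T -> set R) :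
  (forall c, is_primary (Q c)) -> (forall c, minimal_prime I (radical (Q c))) ->
  ideal_pow I t = \bigcap_(c in [set: T]) Q c ->
  ideal_pow I t = symbolic_power I t.
Proof.
move=> Qprim Qmin powE; rewrite predeqE => a; split.
  move=> Ia K [P _ [r [D [i [[_ powD _ _] <- _]]]]].
  by move: Ia; rewrite powD; apply.
pose rs := undup [seq radical (Q c) | c <- enum T].
pose P (i : 'I_(size rs)) := nth set0 rs i.
pose D i := \bigcap_(c in [set c | radical (Q c) = P i]) Q c.
have hP i : exists c, P i = radical (Q c).
  have := mem_nth set0 (ltn_ord i); rewrite -/(P i) mem_undup => /mapP [c _ ->].
  by exists c.
have hidx c : exists i, radical (Q c) = P i.
  have cs : radical (Q c) \in rs by rewrite mem_undup; apply/mapP; exists c; rewrite ?mem_enum.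
  have lt : (index (radical (Q c)) rs < size rs)%N by rewrite index_mem.
  by exists (Ordinal lt); rewrite /P /= nth_index.
have Did i : is_ideal (D i) by apply: is_ideal_bigcap => c _; case: (Qprim c).
have Drad i : radical (D i) = P i.
  rewrite predeqE => b; split=> [[m hm]|Pb].
    by have [c Pc] := hP i; rewrite Pc; exists m; apply: hm.
  have /choice [f hf] : forall c, exists m, radical (Q c) = P i -> Q c (b ^+ m).
    move=> c; have [h|h] := pselect (radical (Q c) = P i); last by exists 0%N.
    by move: Pb; rewrite -h => -[m hm]; exists m.
  exists (\max_c f c)%N => c hc; apply: is_idealX (hf c hc); first by case: (Qprim c).
  exact: leq_bigmax.
have Pmin i : minimal_prime I (P i) by have [c ->] := hP i; apply: Qmin.
have Dprim i : is_primary (D i).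
  have [c Pc] := hP i; split=> // [/(_ c (esym Pc))|b d hbd]; first by case: (Qprim c).
  have [h|h] := pselect (radical (D i) d); [by right | left=> c' hc'].
  have [_ _ /(_ b d (hbd c' hc'))] := Qprim c'; case=> // h'.
  by case: h; rewrite Drad -hc'.
have Pinj i j : P i = P j -> i = j.
  by move/eqP; rewrite nth_uniq ?undup_uniq // => /eqP /val_inj.
have powD : ideal_pow I t = \bigcap_(i in [set: 'I_(size rs)]) D i.
  rewrite powE predeqE => b; split=> hb; first by move=> i _ c _; apply: hb.
  by move=> c _; have [i hi] := hidx c; apply: (hb i).
have Dirr i : ~ (\bigcap_(j in [set j | j != i]) D j `<=` D i).
  move=> hsub; have [Pi IP miniP] := Pmin i.
  (* By minimality of [P i], each [P j] with [j != i] has an element outside [P i], and a power of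
     it lies in [D j]. The product of these powers lies in all [D j] with [j != i] but not in
     [P i]. *)
  have /choice [s hs] : forall j, exists s, j != i -> D j s /\ ~ P i s.
    move=> j; have [->|ji] := eqVneq j i; first by exists 0.
    have [Pj IPj _] := Pmin j.
    have [s [Pjs Pis]] : exists s, P j s /\ ~ P i s.
      apply: contrapT => /forallNP h.
      have ji' : j = i.
        apply/Pinj/miniP => // b Pjb; apply: contrapT => Pib.
        by apply: (h b).
      by rewrite ji' eqxx in ji.
    move: Pjs; rewrite -Drad => -[m hm]; exists (s ^+ m) => _; split=> //.
    by move/(primeX Pi).
  have hprod : D i (\prod_(j | j != i) s j).
    apply: hsub => j /= ji.
    exact: (is_ideal_prod (p := fun j => j != i) (Did j) ji (proj1 (hs j ji))).
  apply: (prime_prod (F := s) Pi (p := fun j => j != i)) => [j ji|].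
    by have [] := hs j ji.
  by rewrite -Drad; exists 1%N; rewrite expr1; apply: hprod.
move=> ha; rewrite powD => i _; apply: ha.
exists (P i); first exact: Pmin.
exists (size rs), D, i; split=> //; split=> // i1 i2.
by rewrite !Drad; apply: Pinj.
Qed.

End IdealPowers.

(** * Minimal covers of a graph *)

Section Covers.

Variables (n : nat) (G : simple_graph 'I_n) (ord : 'I_n -> nat).
Hypothesis ord_inj : injective ord.
Implicit Types (C : {set 'I_(n + n)}) (a b c p q t : 'I_n).

Definition inx C a : bool := lshift n a \in C.
Definition iny C a : bool := rshift n a \in C.
Definition alive C a : bool := ~~ (inx C a && iny C a).
Definition alive_adj C a b : bool := [&& G a b, alive C a & alive C b].

(* These are the sets of variables meeting the initial terms of all the
   binomials attached to paths of [G]. *)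
Definition cover C : bool :=
  [forall a, forall b, (ord a < ord b) && connect (alive_adj C) a b
     ==> inx C a || iny C b].

Lemma coverP C : reflect (forall a b, ord a < ord b -> connect (alive_adj C) a b ->
  inx C a || iny C b) (cover C).
Proof.
apply: (iffP forallP) => [h a b ab cab|h a].
  by have /forallP /(_ b) := h a; rewrite ab cab.
by apply/forallP => b; apply/implyP => /andP []; apply: h.
Qed.

Lemma alive_adj_connect_sym C : connect_sym (alive_adj C).
Proof.
by apply: sym_connect_sym => a b; rewrite /alive_adj adj_sym; congr (_ && _); rewrite andbC.
Qed.

Lemma connect_alive C a b : connect (alive_adj C) a b -> alive C a = alive C b.
Proof.
case/connectP => s; elim: s a => [|c s IH] a /=; first by move=> _ ->.
by case/andP=> /and3P [_ -> hc] hs hb; rewrite -(IH c hs hb).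
Qed.

Lemma connect_dead C a b : ~~ alive C a -> connect (alive_adj C) a b -> a = b.
Proof. by move=> da /connectP [[|c s] //= /andP [/and3P [_ aa _] _] _]; rewrite aa in da. Qed.

Lemma inx_del C a i : inx (C :\ i) a = (lshift n a != i) && inx C a.
Proof. by rewrite /inx in_setD1. Qed.

Lemma iny_del C a i : iny (C :\ i) a = (rshift n a != i) && iny C a.
Proof. by rewrite /iny in_setD1. Qed.

Definition delE :=
  (inx_del, iny_del, eq_lshift, eq_rshift, eq_lrshift, eq_rlshift, andTb).

Variable C : {set 'I_(n + n)}.
Hypothesis Cmin : minset cover C.

Let Ccov : cover C. Proof. exact: minsetp Cmin. Qed.

Lemma min_cover_del i : i \in C -> ~~ cover (C :\ i).
Proof.
move=> iC; apply/negP => cov'.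
have /minsetP [_ /(_ _ cov' (subD1set C i)) E] := Cmin.
by move: iC; rewrite -E !inE eqxx.
Qed.

(** A dead vertex reaches only itself and is its own pivot by default. *)
Definition pivot a : 'I_n :=
  odflt a [pick t | [&& connect (alive_adj C) a t, ~~ inx C t & ~~ iny C t]].

Lemma exists_pivot a : alive C a ->
  exists t, [&& connect (alive_adj C) a t, ~~ inx C t & ~~ iny C t].
Proof.
move=> aa; apply/existsP; apply: contraT; rewrite negb_exists => /forallP no.
have {no} noT c : connect (alive_adj C) a c -> inx C c || iny C c.
  by move=> ac; have := no c; rewrite ac -negb_or negbK.
have [/existsP [b0 h0]|noL] := boolP [exists b, connect (alive_adj C) a b && inx C b].
  case: (arg_maxnP (P := fun b => connect (alive_adj C) a b && inx C b) ord h0) => c /andP [ac xc] cmax.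
  have /negP [] := min_cover_del xc.
  have yc : ~~ iny C c by move: (connect_alive ac); rewrite aa /alive xc => <-.
  have al b : alive (C :\ lshift n c) b = alive C b.
    rewrite /alive !delE /=; case: (b =P c) => [->|] //=.
    by rewrite (negbTE yc) andbF.
  have Eadj : alive_adj (C :\ lshift n c) =2 alive_adj C.
    by move=> p q; rewrite /alive_adj !al.
  apply/coverP => p q pq; rewrite (eq_connect Eadj) => cpq.
  rewrite !delE /=; case: (p =P c) => [pc|_]; last exact: (coverP _ Ccov).
  have aq : connect (alive_adj C) a q by rewrite pc in cpq; apply: connect_trans cpq.
  have /orP [xq|//] := noT q aq.
  have := cmax q; rewrite aq xq => /(_ isT); rewrite /geq /= leqNgt -pc.
  by rewrite pq.
have allR c : connect (alive_adj C) a c -> ~~ inx C c /\ iny C c.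
  move=> ac; have xc : ~~ inx C c.
    by apply: contra noL => xc; apply/existsP; exists c; rewrite ac.
  by split=> //; have := noT c ac; rewrite (negbTE xc).
case: (arg_minnP (P := connect (alive_adj C) a) ord (connect0 (alive_adj C) a)) => c ac cmin.
have [xc yc] := allR c ac.
have /negP [] := min_cover_del yc.
have al b : alive (C :\ rshift n c) b = alive C b.
  rewrite /alive !delE /=; case: (b =P c) => [->|] //=.
  by rewrite (negbTE xc).
have Eadj : alive_adj (C :\ rshift n c) =2 alive_adj C.
  by move=> p q; rewrite /alive_adj !al.
apply/coverP => p q pq; rewrite (eq_connect Eadj) => cpq.
rewrite !delE /=; case: (q =P c) => [qc|_]; last exact: (coverP _ Ccov).
have ap : connect (alive_adj C) a p.
  by apply: connect_trans ac _; rewrite -qc alive_adj_connect_sym.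
by have := cmin p ap; rewrite leqNgt -qc pq.
Qed.

Lemma pivotP a : alive C a ->
  [/\ connect (alive_adj C) a (pivot a), ~~ inx C (pivot a) & ~~ iny C (pivot a)].
Proof.
move=> /exists_pivot [t ht]; rewrite /pivot; case: pickP => [s /and3P //|].
by move/(_ t); rewrite ht.
Qed.

(** Of two pivots in one component, the earlier has no [x] and the later no [y] in [C], against the
    cover condition. *)
Lemma pivot_unique a t : connect (alive_adj C) a t -> ~~ inx C t -> ~~ iny C t ->
  pivot a = t.
Proof.
move=> at_ xt yt; have ta : alive C t by rewrite /alive (negbTE xt).
have [aT xT yT] : [/\ connect (alive_adj C) a (pivot a),
    ~~ inx C (pivot a) & ~~ iny C (pivot a)] by apply: pivotP; rewrite (connect_alive at_).
have tT : connect (alive_adj C) t (pivot a).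
  by apply: connect_trans aT; rewrite alive_adj_connect_sym.
apply: ord_inj; case: (ltngtP (ord (pivot a)) (ord t)) => // lt.
  have := coverP _ Ccov _ _ lt; rewrite alive_adj_connect_sym => /(_ tT).
  by rewrite (negbTE xT) (negbTE yt).
by have := coverP _ Ccov _ _ lt tT; rewrite (negbTE xt) (negbTE yT).
Qed.

Lemma pivot_connect a b : alive C a -> connect (alive_adj C) a b -> pivot a = pivot b.
Proof.
move=> aa ab; have [|bT xT yT] := @pivotP b; first by rewrite -(connect_alive ab).
by apply: pivot_unique => //; apply: connect_trans bT.
Qed.

Lemma pivot_adj a b : G a b -> alive C a -> alive C b -> pivot a = pivot b.
Proof.
by move=> ab aa ba; apply: pivot_connect => //; apply: connect1; rewrite /alive_adj ab aa.
Qed.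

Lemma pivot_id a : ~~ inx C a -> ~~ iny C a -> pivot a = a.
Proof. by move=> xa ya; apply: pivot_unique. Qed.

Lemma pivot_ltn a : alive C a -> inx C a -> ord a < ord (pivot a).
Proof.
move=> aa xa; have [aT xT yT] := pivotP aa.
case: (ltngtP (ord a) (ord (pivot a))) => // [lt|E].
  have := coverP _ Ccov _ _ lt; rewrite alive_adj_connect_sym => /(_ aT).
  by rewrite (negbTE xT); move: aa; rewrite /alive xa /= => /negbTE ->.
by have := ord_inj E => aE; rewrite -aE xa in xT.
Qed.

Lemma pivot_gtn a : alive C a -> iny C a -> ord (pivot a) < ord a.
Proof.
move=> aa ya; have [aT xT yT] := pivotP aa.
case: (ltngtP (ord a) (ord (pivot a))) => // [lt|E].
  have := coverP _ Ccov _ _ lt aT.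
  by rewrite (negbTE yT) orbF; move: aa; rewrite /alive ya andbT => /negbTE ->.
by have := ord_inj E => aE; rewrite -aE ya in yT.
Qed.

(* Otherwise the dead vertex [a] could be revived inside the only alive
   component it touches, by dropping one of its two variables from [C]. *)
Lemma dead_cut a : ~~ alive C a ->
  exists b c, [/\ G a b, G a c, alive C b, alive C c & pivot b != pivot c].
Proof.
rewrite /alive negbK => da; have [xa ya] := andP da.
have deada : ~~ alive C a by rewrite /alive da.
pose P b c := [&& G a b, G a c, alive C b, alive C c & pivot b != pivot c].
suff /existsP [b /existsP [c /and5P ?]] : [exists b, exists c, P b c].
  by exists b, c.
apply: contraT; rewrite negb_exists => /forallP no.
have same b c : G a b -> G a c -> alive C b -> alive C c -> pivot b = pivot c.
  move=> ab ac hb hc; have := no b; rewrite negb_exists => /forallP /(_ c).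
  by rewrite /P ab ac hb hc negbK => /eqP.
(* Without alive neighbours, [a] is isolated among the alive vertices once [x_a] is dropped, so no
   new condition arises. *)
have [/existsP [b /andP [ab hb]]|none] := boolP [exists b, G a b && alive C b]; last first.
  have /negP [] := min_cover_del xa.
  have al b : b != a -> alive (C :\ lshift n a) b = alive C b.
    by move=> ba; rewrite /alive !delE /= ba.
  have noadj b : G a b -> ~~ alive C b.
    by move=> ab; apply: contra none => hb; apply/existsP; exists b; rewrite ab.
  have Eadj : alive_adj (C :\ lshift n a) =2 alive_adj C.
    move=> p q; rewrite /alive_adj; have [->|pa] := eqVneq p a.
      rewrite (negbTE deada) andbF; have [aq|//] := boolP (G a q).
      have qa : q != a by apply: contraTneq aq => ->; rewrite adj_irr.
      by rewrite (al q qa) (negbTE (noadj q aq)) andbF.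
    have [->|qa] := eqVneq q a; last by rewrite !al.
    rewrite (negbTE deada) !andbF; have [pa'|//] := boolP (G p a).
    by rewrite (al p pa) (negbTE (noadj p _)) // adj_sym.
  apply/coverP => p q pq; rewrite (eq_connect Eadj) => cpq.
  rewrite !delE /=; case: (p =P a) => [E|_]; last exact: (coverP _ Ccov).
  by move: pq; rewrite E in cpq *; rewrite (connect_dead deada cpq) ltnn.
have [bT xT yT] := pivotP hb; set t := pivot b in bT xT yT.
(* Reviving [a] only attaches it to the component of [t]: replacing [a] by [t] turns new connections
   into old ones. *)
pose pi p := if p == a then t else p.
have revive C' : (forall p, p != a -> alive C' p = alive C p) ->
    forall p q, connect (alive_adj C') p q -> connect (alive_adj C) (pi p) (pi q).
  move=> al; have nbr q : q != a -> G a q -> alive C' q -> connect (alive_adj C) t q.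
    move=> qa aq; rewrite (al q qa) => hq; rewrite /t (same b q ab aq hb hq).
    by rewrite alive_adj_connect_sym; case: (pivotP hq).
  have step p q : alive_adj C' p q -> connect (alive_adj C) (pi p) (pi q).
    rewrite /pi; case/and3P; have [->|pa] := eqVneq p a.
      have [->|qa] := eqVneq q a; first by rewrite adj_irr.
      by move=> aq _ hq; apply: nbr.
    have [->|qa] := eqVneq q a.
      by move=> pa' hp _; rewrite alive_adj_connect_sym; apply: nbr => //; rewrite adj_sym.
    by rewrite !al // => pq hp hq; apply: connect1; rewrite /alive_adj pq hp.
  move=> p q /connectP [s]; elim: s p => [|r s IH] p /=; first by move=> _ ->.
  by case/andP=> /step pr rs Eq; apply: connect_trans pr (IH r rs Eq).
(* If [a] precedes [t], drop [y_a]: for [p] before [a], the old condition on [p] and [t] already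
   gives [x_p], as [y_t] is not in [C]. Otherwise drop [x_a], symmetrically. *)
case: (ltngtP (ord a) (ord t)) => [at_|ta|/ord_inj E]; last by rewrite -E xa in xT.
  have /negP [] := min_cover_del ya.
  have al p : p != a -> alive (C :\ rshift n a) p = alive C p.
    by move=> pa; rewrite /alive !delE /= pa.
  apply/coverP => p q pq /(revive _ al); rewrite /pi !delE /=.
  have [->|pa] := eqVneq p a; first by rewrite xa.
  have [E|qa] := eqVneq q a; last by move=> ?; apply: (coverP _ Ccov).
  move=> pt; have := coverP _ Ccov p t; rewrite (negbTE yT) /= => -> //.
  by apply: ltn_trans at_; rewrite -E.
have /negP [] := min_cover_del xa.
have al p : p != a -> alive (C :\ lshift n a) p = alive C p.
  by move=> pa; rewrite /alive !delE /= pa.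
apply/coverP => p q pq /(revive _ al); rewrite /pi !delE /=.
have [->|qa] := eqVneq q a; first by rewrite ya orbT.
have [E|pa] := eqVneq p a; last by move=> ?; apply: (coverP _ Ccov).
move=> tq /=; have := coverP _ Ccov t q; rewrite (negbTE xT) /= => -> //.
by apply: ltn_trans ta _; rewrite -E.
Qed.

End Covers.

(** * The primary ideals attached to minimal covers *)

Section VertexPairs.
Variables (n : nat) (A : Type) (f g : 'I_n -> A).

Definition xy_case (i : 'I_(n + n)) : A :=
  match split i with inl a => f a | inr a => g a end.

Lemma xy_casel a : xy_case (lshift n a) = f a.
Proof. by rewrite /xy_case -[lshift n a]/(unsplit (inl a)) unsplitK. Qed.

Lemma xy_caser a : xy_case (rshift n a) = g a.
Proof. by rewrite /xy_case -[rshift n a]/(unsplit (inr a)) unsplitK. Qed.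

End VertexPairs.

Section Congruences.
Local Open Scope ring_scope.
Variables (k : fieldType) (N : nat).
Implicit Types (P : set {mpoly k[N]}).

Lemma ideal_cong_prod (R : comNzRingType) (I : set R) (T : Type) (s : seq T) (u v : T -> R) :
  is_ideal I -> (forall i, I (u i - v i)) -> I (\prod_(i <- s) u i - \prod_(i <- s) v i).
Proof.
move=> hI huv; have [I0 ID IM] := hI.
apply: (big_ind2 (fun a b => I (a - b))) => // [|a b c d hab hcd]; first by rewrite subrr.
have -> : a * c - b * d = c * (a - b) + b * (c - d) by ring.
by apply: ID; apply: IM.
Qed.

Lemma ideal_cong_exp (R : comNzRingType) (I : set R) (u v : R) e :
  is_ideal I -> (e != 0%N -> I (u - v)) -> I (u ^+ e - v ^+ e).
Proof.
move=> hI; case: e => [_|e /(_ isT) huv]; first by rewrite subrr; case: hI.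
by rewrite subrXX mulrC; case: hI => _ _; apply.
Qed.

Lemma ideal_cong_mon P (u v : 'I_N -> {mpoly k[N]}) (m : 'X_{1..N}) :
  is_ideal P -> (forall i, m i != 0%N -> P (u i - v i)) ->
  P (\prod_i u i ^+ m i - \prod_i v i ^+ m i).
Proof. by move=> hP h; apply: ideal_cong_prod => // i; apply: ideal_cong_exp (h i). Qed.

(** After grouping by [g m], the coefficient of each monomial is zero, so the relation survives the
    linear map sending the monomial [v] to [F v]. *)
Lemma linear_ext_eq0 (s : seq 'X_{1..N}) (c : 'X_{1..N} -> k)
    (g : 'X_{1..N} -> 'X_{1..N}) (F : 'X_{1..N} -> {mpoly k[N]}) :
  \sum_(m <- s) c m *: 'X_[g m] = 0 :> {mpoly k[N]} ->
  \sum_(m <- s) c m *: F (g m) = 0.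
Proof.
move=> h; pose U := undup [seq g m | m <- s].
have E m : m \in s -> F (g m) = \sum_(v <- U) (g m == v)%:R *: F v.
  move=> ms; rewrite (bigD1_seq (g m)) ?undup_uniq //=; last first.
    by rewrite mem_undup map_f.
  rewrite eqxx scale1r big1 ?addr0 // => v; rewrite eq_sym => /negbTE ->.
  exact: scale0r.
rewrite big_seq (eq_bigr (fun m => \sum_(v <- U) (c m * (g m == v)%:R) *: F v)); last first.
  move=> m ms; rewrite [in LHS](E m ms) scaler_sumr; apply: eq_bigr => v _.
  by rewrite scalerA.
rewrite -big_seq exchange_big /= big1 // => v _; rewrite -scaler_suml.
have -> : \sum_(m <- s) c m * (g m == v)%:R = (\sum_(m <- s) c m *: 'X_[g m] : {mpoly k[N]})@_v.
  by rewrite raddf_sum /=; apply: eq_bigr => m _; rewrite mcoeffZ mcoeffX.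
by rewrite h mcoeff0 scale0r.
Qed.

Lemma wfil_exp w (f : {mpoly k[N]}) e : wfil w 1 f -> wfil w e (f ^+ e).
Proof.
move=> hf; elim: e => [|e IH]; first exact: wfil0n.
by rewrite exprS -add1n; apply: wfilM.
Qed.

End Congruences.

Section EdgeBinomials.
Local Open Scope ring_scope.
Variables (k : fieldType) (n : nat) (G : simple_graph 'I_n).
Implicit Types (P : set {mpoly k[n + n]}) (a b c : 'I_n).

Notation J := (binomial_edge_ideal k G).
Notation bin := (edge_binomial k).

Lemma mem_edge_ideal a b : G a b -> J (bin a b).
Proof. by move=> ab; apply: mem_ideal_gen; exists a, b. Qed.

(** Three-term relation among the 2-minors of a matrix with two rows. *)
Lemma edge_binomial_xtrans a b c :
  xvar k b * bin a c = xvar k a * bin b c + xvar k c * bin a b.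
Proof. by rewrite /edge_binomial; ring. Qed.

Lemma edge_binomial_ytrans a b c :
  yvar k b * bin a c = yvar k a * bin b c + yvar k c * bin a b.
Proof. by rewrite /edge_binomial; ring. Qed.

End EdgeBinomials.

Section CoverIdeals.
Local Open Scope ring_scope.
Local Open Scope classical_set_scope.

Variables (k : fieldType) (n : nat) (G : simple_graph 'I_n) (ord : 'I_n -> nat).
Hypothesis ord_inj : injective ord.
Variable C : {set 'I_(n + n)}.
Hypothesis Cmin : minset (cover G ord) C.

Notation S := {mpoly k[n + n]}.
Notation J := (binomial_edge_ideal k G).
Notation bin := (edge_binomial k).
Notation T := (pivot G C).
Implicit Types (m : 'X_{1..n + n}) (f g : S) (i : 'I_(n + n)).

(* A point near a generic point of the component: every alive vertex [a] is
   proportional to its pivot [T a], up to a perturbation in the direction of its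
   variable in [C]; the other variable of [a] is used as the proportionality
   factor. *)
Definition factor a : 'X_{1..n + n} :=
  if inx C a then U_(rshift n a)%MM else if iny C a then U_(lshift n a)%MM else 0%MM.

Definition gen_mon : 'I_(n + n) -> 'X_{1..n + n} :=
  xy_case (fun a => factor a + U_(lshift n (T a)))%MM
          (fun a => factor a + U_(rshift n (T a)))%MM.

Definition vertex_of : 'I_(n + n) -> 'I_n := xy_case id id.

Definition pert i : S :=
  (i \in C)%:R *: 'X_i + (alive C (vertex_of i))%:R *: 'X_[gen_mon i].

Definition low_mon i : 'X_{1..n + n} := if i \in C then U_(i)%MM else gen_mon i.

Definition ord_wt : 'I_(n + n) -> nat := xy_case ord (fun=> 0%N).
(** Chosen so that the lowest monomial of [pert i] has weight [ord_wt i]. If [a] is alive with [y_a]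
    in [C], then [x_a] is sent to [x_a x_(T a)], so it only gets [ord a - ord (T a)]; nothing is
    truncated, as [T a] precedes [a]. *)
Definition pert_wt : 'I_(n + n) -> nat :=
  xy_case (fun a => ord a - (if alive C a && iny C a then ord (T a) else 0))%N (fun=> 0%N).
Definition cover_wt i : nat := i \in C.

Notation pert_map := (comp_mpoly [tuple pert i | i < n + n]).

Definition mon_map (h : 'I_(n + n) -> 'X_{1..n + n}) m : 'X_{1..n + n} :=
  (\sum_i h i *+ m i)%MM.

Let meml a : (lshift n a \in C) = inx C a. Proof. by []. Qed.
Let memr a : (rshift n a \in C) = iny C a. Proof. by []. Qed.

Lemma vertex_ofl a : vertex_of (lshift n a) = a. Proof. exact: xy_casel. Qed.
Lemma vertex_ofr a : vertex_of (rshift n a) = a. Proof. exact: xy_caser. Qed.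
Lemma ord_wtl a : ord_wt (lshift n a) = ord a. Proof. exact: xy_casel. Qed.
Lemma ord_wtr a : ord_wt (rshift n a) = 0%N. Proof. exact: xy_caser. Qed.
Lemma gen_monl a : gen_mon (lshift n a) = (factor a + U_(lshift n (T a)))%MM.
Proof. exact: xy_casel. Qed.
Lemma gen_monr a : gen_mon (rshift n a) = (factor a + U_(rshift n (T a)))%MM.
Proof. exact: xy_caser. Qed.
Lemma pert_wtl a :
  pert_wt (lshift n a) = (ord a - (if alive C a && iny C a then ord (T a) else 0))%N.
Proof. exact: xy_casel. Qed.
Lemma pert_wtr a : pert_wt (rshift n a) = 0%N. Proof. exact: xy_caser. Qed.

Lemma pert_mapX m : pert_map 'X_[m] = \prod_i pert i ^+ m i.
Proof. by rewrite comp_mpolyX; apply: eq_bigr => i _; rewrite tnth_mktuple. Qed.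

Lemma pert_map_sum f : pert_map f = \sum_(m <- msupp f) f@_m *: pert_map 'X_[m].
Proof. by rewrite {1}[f]mpolyE raddf_sum; apply: eq_bigr => m _; exact: comp_mpolyZ. Qed.

Lemma pert_mapU i : pert_map 'X_i = pert i.
Proof.
rewrite pert_mapX (bigD1 i) //= mnm1E eqxx expr1 big1 ?mulr1 // => j ji.
by rewrite mnm1E eq_sym (negbTE ji) expr0.
Qed.

Lemma alive_notin i : i \notin C -> alive C (vertex_of i).
Proof.
rewrite /alive; case: (split_ordP i) => a ->; rewrite ?meml ?memr => /negbTE h.
  by rewrite vertex_ofl h.
by rewrite vertex_ofr h andbF.
Qed.

Lemma factor_pivot a : ~~ inx C a -> ~~ iny C a -> factor a = 0%MM.
Proof. by rewrite /factor => /negbTE -> /negbTE ->. Qed.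

(** An alive [a] precedes its pivot if [x_a] is in [C] and follows it if [y_a] is; hence, for a
    variable in [C], the generic term of [pert i] is strictly heavier than the variable itself. *)
Lemma lowform_pert i : lowform pert_wt (pert i) (low_mon i).
Proof.
rewrite /pert /low_mon; have [iC|iC] := boolP (i \in C); last first.
  by rewrite scale0r add0r (alive_notin iC) scale1r lowformX.
rewrite scale1r /lowform addrAC subrr add0r mwtU.
have [al|] := boolP (alive C (vertex_of i)); last by rewrite scale0r wfil_zero.
rewrite scale1r; apply: wfil_leq (wfilX _ _ _).
case: (split_ordP i) iC al => a ->; rewrite ?vertex_ofl ?vertex_ofr ?meml ?memr => iC al.
  have xa : inx C a by [].
  have ya : ~~ iny C a by move: al; rewrite /alive xa.
  have [_ _ yT] := pivotP Cmin al.
  rewrite gen_monl /factor xa mwtD !mwtU pert_wtr !pert_wtl (negbTE ya) (negbTE yT).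
  by rewrite !andbF !subn0; apply: (pivot_ltn ord_inj Cmin).
have ya : iny C a by [].
have xa : ~~ inx C a by move: al; rewrite /alive ya andbT.
rewrite gen_monr /factor (negbTE xa) ya mwtD !mwtU !pert_wtr pert_wtl al ya addn0.
by rewrite subn_gt0; apply: (pivot_gtn ord_inj Cmin).
Qed.

Lemma pert_wt_low_mon i : mwt pert_wt (low_mon i) = ord_wt i.
Proof.
rewrite /low_mon; case: (split_ordP i) => a ->; rewrite ?meml ?memr; last first.
  rewrite ord_wtr gen_monr; case: ifP => [_|ya]; first by rewrite mwtU pert_wtr.
  rewrite mwtD mwtU pert_wtr addn0 /factor ya; case: ifP => _; last by rewrite mwt0.
  by rewrite mwtU pert_wtr.
rewrite ord_wtl gen_monl; case: ifP => xa.
  by rewrite mwtU pert_wtl /alive xa /= andNb subn0.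
have al : alive C a by rewrite /alive xa.
have [_ _ yT] := pivotP Cmin al.
rewrite mwtD mwtU pert_wtl (negbTE yT) andbF subn0 /factor xa; case: ifP => ya.
  rewrite mwtU pert_wtl al ya subnK // ltnW //.
  exact: (pivot_gtn ord_inj Cmin).
by rewrite mwt0 (pivot_id ord_inj Cmin) ?xa ?ya.
Qed.

(** The factor of an alive vertex is trivial or its variable outside [C], and both variables of a
    pivot are outside [C]. *)
Lemma cover_wt_gen_mon i : alive C (vertex_of i) -> mwt cover_wt (gen_mon i) = 0%N.
Proof.
have cw_factor a : alive C a -> mwt cover_wt (factor a) = 0%N.
  rewrite /factor /alive; case: ifP => [xa /= ya|xa _].
    by rewrite mwtU /cover_wt memr (negbTE ya).
  by case: ifP => _; rewrite ?mwt0 ?mwtU // /cover_wt meml xa.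
case: (split_ordP i) => a ->; rewrite ?vertex_ofl ?vertex_ofr => al;
  have [_ xT yT] := pivotP Cmin al;
  rewrite ?gen_monl ?gen_monr mwtD cw_factor // mwtU /cover_wt add0n.
  by rewrite meml (negbTE xT).
by rewrite memr (negbTE yT).
Qed.

Lemma cover_wt_low_mon i : mwt cover_wt (low_mon i) = cover_wt i.
Proof.
rewrite /low_mon; case: ifP => [_|/negbT iC]; first by rewrite mwtU.
by rewrite cover_wt_gen_mon ?alive_notin // /cover_wt (negbTE iC).
Qed.

Lemma mwt_mon_map w h m : mwt w (mon_map h m) = (\sum_i mwt w (h i) * m i)%N.
Proof.
rewrite /mon_map; elim/big_rec2: _ => [|i e m' _ <-]; first exact: mwt0.
by rewrite mwtD mwtMn.
Qed.

Lemma mon_mapE h m j : mon_map h m j = (\sum_i h i j * m i)%N.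
Proof. by rewrite /mon_map mnm_sumE; apply: eq_bigr => i _; rewrite mulmnE. Qed.

Lemma lowform_pert_map m : lowform pert_wt (pert_map 'X_[m]) (mon_map low_mon m).
Proof.
rewrite pert_mapX; apply: lowform_prod => i.
by apply: lowform_exp; apply: lowform_pert.
Qed.

Lemma pert_wt_mon_map m : mwt pert_wt (mon_map low_mon m) = mwt ord_wt m.
Proof. by rewrite mwt_mon_map; apply: eq_bigr => i _; rewrite pert_wt_low_mon. Qed.

Lemma cover_wt_mon_map m : mwt cover_wt (mon_map low_mon m) = mwt cover_wt m.
Proof. by rewrite mwt_mon_map; apply: eq_bigr => i _; rewrite cover_wt_low_mon. Qed.

Definition is_pivot i : bool := ~~ inx C (vertex_of i) && ~~ iny C (vertex_of i).

Lemma vertex_of_pivot a : alive C a ->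
  is_pivot (lshift n (T a)) /\ is_pivot (rshift n (T a)).
Proof.
by move=> /(pivotP Cmin) [_ xT yT]; rewrite /is_pivot vertex_ofl vertex_ofr xT yT.
Qed.

Lemma gen_mon_pivot i : is_pivot i -> gen_mon i = U_(i)%MM.
Proof.
rewrite /is_pivot; case: (split_ordP i) => a ->.
  by rewrite vertex_ofl => /andP [xa ya]; rewrite gen_monl factor_pivot // add0m (pivot_id ord_inj Cmin).
by rewrite vertex_ofr => /andP [xa ya]; rewrite gen_monr factor_pivot // add0m (pivot_id ord_inj Cmin).
Qed.

Lemma low_mon_pivot i : is_pivot i -> low_mon i = U_(i)%MM.
Proof. by move=> pi; rewrite /low_mon gen_mon_pivot // if_same. Qed.

Lemma gen_mon_nonpivot i j : alive C (vertex_of i) -> ~~ is_pivot j ->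
  gen_mon i j = factor (vertex_of i) j.
Proof.
move=> al pj; case: (split_ordP i) al => a ->; rewrite ?vertex_ofl ?vertex_ofr;
  move=> /vertex_of_pivot [px py]; rewrite ?gen_monl ?gen_monr mnmDE mnm1E.
  case: eqP => [E|_]; [by rewrite -E px in pj | exact: addn0].
case: eqP => [E|_]; [by rewrite -E py in pj | exact: addn0].
Qed.

Lemma low_mon_nonpivot i j : ~~ is_pivot j -> low_mon i j = (i == j).
Proof.
move=> pj; rewrite /low_mon; case: ifP => [_|/negbT iC]; first by rewrite mnm1E.
have al := alive_notin iC; rewrite gen_mon_nonpivot // /factor.
case: (split_ordP i) iC => a ->; rewrite ?vertex_ofl ?vertex_ofr ?meml ?memr => /negbTE iC.
  rewrite iC; case: ifP => ya; first by rewrite mnm1E.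
  rewrite mnm0E; case: eqP => [E|] //; move: pj.
  by rewrite -E /is_pivot vertex_ofl iC ya.
case: ifP => xa; first by rewrite mnm1E.
rewrite iC mnm0E; case: eqP => [E|] //; move: pj.
by rewrite -E /is_pivot vertex_ofr iC xa.
Qed.

(** The map is unitriangular on exponents: those of non-pivot variables are unchanged, and those of
    pivot variables grow by amounts depending only on the non-pivot ones. *)
Lemma mon_map_low_inj : injective (mon_map low_mon).
Proof.
move=> m m' E; have {}E j : mon_map low_mon m j = mon_map low_mon m' j by rewrite E.
have nonpiv j : ~~ is_pivot j -> m j = m' j.
  move=> pj; have h m0 : mon_map low_mon m0 j = m0 j.
    rewrite mon_mapE (bigD1 j) //= low_mon_nonpivot // eqxx mul1n big1 ?addn0 // => i ij.
    by rewrite low_mon_nonpivot // (negbTE ij).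
  by rewrite -(h m) -(h m') E.
apply/mnmP => j; have [pj|/nonpiv //] := boolP (is_pivot j).
have h m0 : mon_map low_mon m0 j =
    (m0 j + \sum_(i | ~~ is_pivot i) low_mon i j * m0 i)%N.
  rewrite mon_mapE (bigID is_pivot) /=; congr (_ + _)%N.
  rewrite (bigD1 j) //= low_mon_pivot // mnm1E eqxx mul1n big1 ?addn0 //.
  by move=> i /andP [pi ij]; rewrite low_mon_pivot // mnm1E (negbTE ij).
have := E j; rewrite !h => /eqP; rewrite (eq_bigr (fun i => low_mon i j * m' i)%N) => [|i /nonpiv -> //].
by rewrite eqn_add2r => /eqP.
Qed.

Definition cover_ideal (t : nat) : set S := [set f | wfil cover_wt t (pert_map f)].

Lemma cover_ideal_is_ideal t : is_ideal (cover_ideal t).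
Proof.
have [I0 ID IM] := wfil_ideal k cover_wt t.
split=> /= [|f g hf hg|r f hf]; first by rewrite /cover_ideal /= rmorph0.
  by rewrite /cover_ideal /= rmorphD; apply: ID.
by rewrite /cover_ideal /= rmorphM; apply: IM.
Qed.

Lemma cover_ideal_prime : is_prime (cover_ideal 1).
Proof.
split; first exact: cover_ideal_is_ideal.
  rewrite /cover_ideal /= rmorph1 => /wfilP /(_ 0%MM).
  by rewrite mcoeff1 eqxx oner_eq0 mwt0 => /(_ isT).
by move=> f g; rewrite /cover_ideal /= rmorphM => /wfil_primary [|]; [left | right].
Qed.

Lemma cover_ideal_radical t : (0 < t)%N -> radical (cover_ideal t) = cover_ideal 1.
Proof.
move=> t0; rewrite predeqE => f; split=> [[m hm]|hf].
  by apply: (primeX (m := m) cover_ideal_prime); exact: (wfil_leq t0 hm).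
by exists t; rewrite /cover_ideal /= rmorphXn; apply: wfil_exp.
Qed.

Lemma cover_ideal_primary t : (0 < t)%N -> is_primary (cover_ideal t).
Proof.
move=> t0; split; first exact: cover_ideal_is_ideal.
  by move=> h; have [_ h1 _] := cover_ideal_prime; apply: h1; exact: (wfil_leq t0 h).
move=> f g; rewrite cover_ideal_radical // /cover_ideal /= rmorphM.
by move=> /wfil_primary [|]; [left | right].
Qed.

(** Distinct monomials have images with distinct lowest monomials of unchanged weight, so that of
    [m] cannot cancel in the image of [f]; its degree in [C] is that of [m]. *)
Lemma cover_wt_low f t m : cover_ideal t f -> f@_m != 0 ->
  (forall m', f@_m' != 0 -> (mwt ord_wt m <= mwt ord_wt m')%N) ->
  (t <= mwt cover_wt m)%N.
Proof.
move=> hf fm mmin; rewrite -cover_wt_mon_map; apply/(wfilP _ _ _ hf).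
suff -> : (pert_map f)@_(mon_map low_mon m) = f@_m by [].
rewrite pert_map_sum raddf_sum /= big_seq.
rewrite (eq_bigr (fun m' => f@_m' * (m' == m)%:R)) => [|m' m's].
  rewrite -big_seq (bigD1_seq m) ?msupp_uniq ?mcoeff_msupp //= eqxx mulr1.
  by rewrite big1 ?addr0 // => m' /negbTE ->; exact: mulr0.
rewrite mcoeffZ (lowform_coef (lowform_pert_map m')) ?(inj_eq mon_map_low_inj) //.
by rewrite !pert_wt_mon_map mmin // -mcoeff_msupp.
Qed.

End CoverIdeals.

(** * Minimality of the prime attached to a minimal cover *)

Section CoverPrimes.
Local Open Scope ring_scope.
Local Open Scope classical_set_scope.

Variables (k : fieldType) (n : nat) (G : simple_graph 'I_n) (ord : 'I_n -> nat).
Hypothesis ord_inj : injective ord.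
Variable C : {set 'I_(n + n)}.
Hypothesis Cmin : minset (cover G ord) C.

Notation S := {mpoly k[n + n]}.
Notation J := (binomial_edge_ideal k G).
Notation bin := (edge_binomial k).
Notation T := (pivot G C).
Notation gm := (gen_mon G C).
Notation pert_map := (comp_mpoly [tuple pert k G C i | i < n + n]).
Implicit Types (m : 'X_{1..n + n}) (f g : S) (i : 'I_(n + n)).

Lemma pert_alive i : alive C (vertex_of i) ->
  wfil (cover_wt C) 1 (pert k G C i - 'X_[gm i]).
Proof.
move=> al; rewrite /pert al scale1r addrK.
have [iC|_] := boolP (i \in C); last by rewrite scale0r wfil_zero.
rewrite scale1r; apply: wfil_leq (wfilX _ _ _).
by rewrite mwtU /cover_wt iC.
Qed.

Lemma dead_mem i : ~~ alive C (vertex_of i) -> i \in C.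
Proof. by apply: contraR => /alive_notin. Qed.

Lemma pert_dead i : ~~ alive C (vertex_of i) -> wfil (cover_wt C) 1 (pert k G C i).
Proof.
move=> da; rewrite /pert (dead_mem da) (negbTE da) scale0r addr0 scale1r.
by apply: wfil_leq (wfilX _ _ _); rewrite mwtU /cover_wt (dead_mem da).
Qed.

(** Modulo the ideal generated by [C], the substitution kills all other monomials and sends these to
    the monomials [mon_map gm m]. *)
Definition alive_mon m : bool := [forall i, (m i != 0%N) ==> alive C (vertex_of i)].

Lemma alive_monP m : reflect (forall i, m i != 0%N -> alive C (vertex_of i)) (alive_mon m).
Proof. by apply: (iffP forallP) => h i; apply/implyP/h. Qed.

Lemma mpolyX_gen m : 'X_[mon_map gm m] = \prod_i 'X_[gm i] ^+ m i :> S.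
Proof. by rewrite /mon_map mprodXnE. Qed.

Lemma pert_map_alive m : alive_mon m ->
  wfil (cover_wt C) 1 (pert_map 'X_[m] - 'X_[mon_map gm m]).
Proof.
move/alive_monP=> al; rewrite pert_mapX mpolyX_gen.
apply: (ideal_cong_mon (wfil_ideal _ _ _)) => i /al; exact: pert_alive.
Qed.

Lemma pert_map_dead m : ~~ alive_mon m -> wfil (cover_wt C) 1 (pert_map 'X_[m]).
Proof.
rewrite negb_forall => /existsP [i]; rewrite negb_imply => /andP [mi da].
rewrite pert_mapX (bigD1 i) //=; apply: wfilMr.
by case: (m i) mi => // e _; rewrite exprS; apply: wfilMr; apply: pert_dead.
Qed.

Lemma cover_wt_gen m : alive_mon m -> mwt (cover_wt C) (mon_map gm m) = 0%N.
Proof.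
move/alive_monP=> al; rewrite mwt_mon_map big1 // => i _.
have [->|mi] := eqVneq (m i) 0%N; first exact: muln0.
by rewrite (cover_wt_gen_mon Cmin) ?al.
Qed.

Lemma mon_mapU i : mon_map gm U_(i)%MM = gm i.
Proof.
apply/mnmP => j; rewrite mon_mapE (bigD1 i) //= mnm1E eqxx muln1 big1 ?addn0 // => l li.
by rewrite mnm1E eq_sym (negbTE li) muln0.
Qed.

Lemma mon_mapD m m' : mon_map gm (m + m')%MM = (mon_map gm m + mon_map gm m')%MM.
Proof.
apply/mnmP => j; rewrite mnmDE !mon_mapE -big_split; apply: eq_bigr => i _.
by rewrite mnmDE mulnDr.
Qed.

Lemma alive_monU i : alive C (vertex_of i) -> alive_mon U_(i)%MM.
Proof.
by move=> al; apply/alive_monP => j; rewrite mnm1E; case: (i =P j) => // <-.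
Qed.

Lemma alive_monD m m' : alive_mon m -> alive_mon m' -> alive_mon (m + m')%MM.
Proof.
move=> /alive_monP al /alive_monP al'; apply/alive_monP => i.
by rewrite mnmDE addn_eq0 negb_and => /orP [/al|/al'].
Qed.

Lemma alive_mon_notin m : alive_mon m -> ~ cover_ideal G C 1 ('X_[m] : S).
Proof.
move=> al h; have := wfilB h (pert_map_alive al); rewrite subKr.
by move/wfilP/(_ (mon_map gm m)); rewrite mcoeffX eqxx oner_eq0 cover_wt_gen // => /(_ isT).
Qed.

Lemma alive_var_notin i : alive C (vertex_of i) -> ~ cover_ideal G C 1 ('X_i : S).
Proof. by move=> /alive_monU /alive_mon_notin. Qed.

Lemma edge_binomialE a b :
  bin a b = 'X_[(U_(lshift n a) + U_(rshift n b))] - 'X_[(U_(rshift n a) + U_(lshift n b))].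
Proof. by rewrite !mpolyXD. Qed.

Lemma alive_bin a b : alive C a -> alive C b ->
  alive_mon (U_(lshift n a) + U_(rshift n b))%MM /\
  alive_mon (U_(rshift n a) + U_(lshift n b))%MM.
Proof.
by move=> ha hb; split; apply: alive_monD; apply: alive_monU;
  rewrite ?vertex_ofl ?vertex_ofr.
Qed.

(** Modulo [C], the two terms become a common factor times [x_(T a) y_(T b)] and [y_(T a) x_(T b)],
    which agree only for equal pivots. *)
Lemma cover_ideal_bin a b : alive C a -> alive C b ->
  cover_ideal G C 1 (bin a b) <-> T a = T b.
Proof.
move=> ha hb; have [h1 h2] := alive_bin ha hb.
have h := wfilB (pert_map_alive h1) (pert_map_alive h2).
set u := mon_map _ _ in h; set v := mon_map gm _ in h.
have uE : u = (factor C a + factor C b + (U_(lshift n (T a)) + U_(rshift n (T b))))%MM.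
  by rewrite /u mon_mapD !mon_mapU gen_monl gen_monr; apply/mnmP => i; rewrite !mnmDE; lia.
have vE : v = (factor C a + factor C b + (U_(rshift n (T a)) + U_(lshift n (T b))))%MM.
  by rewrite /v mon_mapD !mon_mapU gen_monl gen_monr; apply/mnmP => i; rewrite !mnmDE; lia.
have E : pert_map (bin a b) = pert_map 'X_[(U_(lshift n a) + U_(rshift n b))]
    - pert_map 'X_[(U_(rshift n a) + U_(lshift n b))] by rewrite edge_binomialE rmorphB.
split=> [hbin|TT]; last first.
  rewrite /cover_ideal /= E -[X in wfil _ _ X]subr0.
  rewrite -[X in _ - X](subrr 'X_[u]).
  have uv : u = v by rewrite uE vE TT [(U_(lshift n (T b)) + _)%MM]addmC.
  by move: h; rewrite -uv; congr (wfil _ _ _); ring.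
apply/eqP; apply: contraT => nT.
have : wfil (cover_wt C) 1 ('X_[u] - 'X_[v] : S).
  by move: (wfilB hbin h); rewrite E; congr (wfil _ _ _); ring.
move/wfilP/(_ u); rewrite mcoeffB !mcoeffX eqxx cover_wt_gen //.
suff -> : (v == u) = false by rewrite subr0 oner_eq0 => /(_ isT).
apply/eqP => /(congr1 (fun m : 'X_{1..n + n} => m (lshift n (T a)))).
rewrite uE vE !mnmDE !mnm1E eqxx !eq_lshift eq_rlshift eq_sym (negbTE nT).
by rewrite eq_rlshift; lia.
Qed.

Lemma binomial_edge_ideal_sub : J `<=` cover_ideal G C 1.
Proof.
have hI := cover_ideal_is_ideal k G C 1; have [_ ID IM] := hI.
apply: ideal_gen_sub => // _ [a [b [ab ->]]].
have dead c : ~~ alive C c ->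
    cover_ideal G C 1 (xvar k c) /\ cover_ideal G C 1 (yvar k c).
  by move=> dc; split; rewrite /cover_ideal /= pert_mapU; apply: pert_dead;
    rewrite ?vertex_ofl ?vertex_ofr.
have [ha|/dead [xa ya]] := boolP (alive C a); last first.
  by apply: is_idealB => //; rewrite mulrC; apply: IM.
have [hb|/dead [xb yb]] := boolP (alive C b); last by apply: is_idealB => //; apply: IM.
by apply/cover_ideal_bin => //; apply: pivot_adj Cmin _ _ ab ha hb.
Qed.

Lemma ideal_pow_cover_ideal t : ideal_pow J t `<=` cover_ideal G C t.
Proof.
apply: ideal_pow_filtration => [m||m a b ha /binomial_edge_ideal_sub hb].
- exact: cover_ideal_is_ideal.
- by rewrite predeqE => f; split=> // _; apply: wfil0n.
- by rewrite /cover_ideal /= rmorphM -addn1; apply: wfilM.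
Qed.

Section Minimality.

Variable P : set S.
Hypotheses (Pprime : is_prime P) (JP : J `<=` P) (PC : P `<=` cover_ideal G C 1).

Let Pid : is_ideal P. Proof. by case: Pprime. Qed.

Let Pedge a b : G a b -> P (bin a b).
Proof. by move=> ab; apply: JP; apply: mem_edge_ideal. Qed.

(** Induction along an alive path by the three-term relation; [x_c] can be cancelled because [P]
    lies in the cover ideal, which contains no alive variable. *)
Lemma prime_bin_connect a b : alive C a -> connect (alive_adj G C) a b -> P (bin a b).
Proof.
have [P0 PD PM] := Pid; have [_ _ Pmul] := Pprime.
move=> ha /connectP [s]; elim: s a ha => [|c s IH] a ha /=.
  move=> _ ->; rewrite /edge_binomial.
  by have -> : xvar k a * yvar k a - yvar k a * xvar k a = 0 by ring.
case/andP=> /and3P [ac _ hc] hs Eb; have hcb := IH c hc hs Eb.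
have : P (xvar k c * bin a b).
  by rewrite edge_binomial_xtrans; apply: PD; apply: (PM) => //; apply: Pedge.
case/Pmul => // /PC /alive_var_notin []; by rewrite vertex_ofl.
Qed.

Lemma prime_bin_pivot a : alive C a -> P (bin a (T a)).
Proof. by move=> ha; apply: prime_bin_connect => //; case: (pivotP Cmin ha). Qed.

(** A dead [a] has alive neighbours [b] and [c] with distinct pivots. By the three-term relations,
    [x_a] and [y_a] multiply the binomial of [b] and [c] into [P], which does not contain that
    binomial. *)
Lemma prime_dead i : ~~ alive C (vertex_of i) -> P 'X_i.
Proof.
have [P0 PD PM] := Pid; have [_ _ Pmul] := Pprime.
have main a : ~~ alive C a -> P (xvar k a) /\ P (yvar k a).
  move=> da; have [b [c [ab ac hb hc Tbc]]] := dead_cut ord_inj Cmin da.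
  have nbc : ~ P (bin b c).
    by move=> /PC /(cover_ideal_bin hb hc) /eqP; rewrite (negbTE Tbc).
  have Pab : P (bin a c) by apply: Pedge.
  have Pba : P (bin b a) by apply: Pedge; rewrite adj_sym.
  have : P (xvar k a * bin b c) by rewrite edge_binomial_xtrans; apply: (PD); apply: (PM).
  case/Pmul => // xa; split=> //.
  have : P (yvar k a * bin b c) by rewrite edge_binomial_ytrans; apply: (PD); apply: (PM).
  by case/Pmul.
by case: (split_ordP i) => a ->; rewrite ?vertex_ofl ?vertex_ofr => /main [].
Qed.

(** The pivot variable (or 1, at a pivot) by which an alive variable is multiplied to agree with its
    generic monomial modulo [P]; it depends only on the vertex. *)
Definition scale_mon i : 'X_{1..n + n} :=
  let a := vertex_of i in
  if inx C a then U_(rshift n (T a))%MM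
  else if iny C a then U_(lshift n (T a))%MM else 0%MM.

Lemma prime_gen_mon i : alive C (vertex_of i) -> P ('X_[scale_mon i] * 'X_i - 'X_[gm i]).
Proof.
have [P0 PD PM] := Pid; rewrite /scale_mon.
case: (split_ordP i) => a ->; rewrite ?vertex_ofl ?vertex_ofr => ha;
  have hT := prime_bin_pivot ha; rewrite ?gen_monl ?gen_monr /factor mpolyXD.
- case: ifP => xa; first by move: hT; rewrite /edge_binomial /xvar /yvar mulrC.
  case: ifP => ya; first by rewrite mulrC subrr.
  by rewrite (pivot_id ord_inj Cmin) ?xa ?ya // mpolyX0 subrr.
- case: ifP => xa; first by rewrite mulrC subrr.
  case: ifP => ya; last by rewrite (pivot_id ord_inj Cmin) ?xa ?ya // mpolyX0 subrr.
  have -> : 'X_[U_(lshift n (T a))] * 'X_[U_(rshift n a)] -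
      'X_[U_(lshift n a)] * 'X_[U_(rshift n (T a))] = -1 * bin a (T a) :> S.
    by rewrite /edge_binomial /xvar /yvar; ring.
  exact: PM.
Qed.

Definition main_var a : 'I_(n + n) := if inx C a then rshift n a else lshift n a.

(** For an alive [a], [main_var a] is the variable in [factor a]: it occurs once in the generic
    monomials of [x_a] and [y_a], and in those of no other alive vertex. *)
Lemma gen_mon_main_var a m : ~~ (~~ inx C a && ~~ iny C a) -> alive_mon m ->
  mon_map gm m (main_var a) = (m (lshift n a) + m (rshift n a))%N.
Proof.
move=> pa /alive_monP al.
have nm : ~~ is_pivot C (main_var a).
  by rewrite /is_pivot /main_var; case: ifP => _; rewrite ?vertex_ofl ?vertex_ofr.
have E i : (gm i (main_var a) * m i = (vertex_of i == a) * m i)%N.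
  have [->|/al hi] := eqVneq (m i) 0%N; first by rewrite !muln0.
  congr (_ * _)%N; rewrite (gen_mon_nonpivot Cmin) // /factor /main_var.
  case: (vertex_of i =P a) => [->|ne].
    move: pa; case: (boolP (inx C a)) => [_ _|_]; first by rewrite mnm1E eqxx.
    by rewrite /= negbK => ->; rewrite mnm1E eqxx.
  move/eqP/negbTE: ne => ne; case: (inx C (vertex_of i)); last case: (iny C (vertex_of i));
    case: (inx C a);
    by rewrite ?mnm0E ?mnm1E ?eq_lshift ?eq_rshift ?eq_lrshift ?eq_rlshift ?ne.
rewrite mon_mapE (eq_bigr _ (fun i _ => E i)) big_split_ord /=; congr (_ + _)%N.
  rewrite (bigD1 a) //= vertex_ofl eqxx mul1n big1 ?addn0 // => b ba.
  by rewrite vertex_ofl (negbTE ba).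
rewrite (bigD1 a) //= vertex_ofr eqxx mul1n big1 ?addn0 // => b ba.
by rewrite vertex_ofr (negbTE ba).
Qed.

(* Both sides become the same monomial after multiplication by the common
   monomial [mon_map scale_mon m], which only involves pivots. *)
Lemma prime_same_gen m m' : alive_mon m -> alive_mon m' ->
  mon_map gm m = mon_map gm m' -> P ('X_[m] - 'X_[m']).
Proof.
have [P0 PD PM] := Pid; have [_ _ Pmul] := Pprime.
move=> al al' E.
(* The scaling monomial depends only on the total degrees of [m0] in the two variables of each
   non-pivot vertex, hence only on the generic image. *)
have scE m0 : alive_mon m0 -> mon_map scale_mon m0 =
    (\sum_a scale_mon (lshift n a) *+
      (if ~~ inx C a && ~~ iny C a then 0%N else mon_map gm m0 (main_var a)))%MM.
  move=> al0; rewrite /mon_map big_split_ord /= -big_split /=; apply: eq_bigr => a _.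
  have -> : scale_mon (rshift n a) = scale_mon (lshift n a).
    by rewrite /scale_mon vertex_ofl vertex_ofr.
  case: ifP => [/andP [xa ya]|/negbT pa].
    rewrite /scale_mon vertex_ofl (negbTE xa) (negbTE ya).
    by apply/mnmP => j; rewrite !mnmDE !mulmnE mnm0E.
  rewrite gen_mon_main_var //; apply/mnmP => j.
  by rewrite !mnmDE !mulmnE mulnDr.
have sE : mon_map scale_mon m = mon_map scale_mon m'.
  by rewrite !scE //; apply: eq_bigr => a _; rewrite E.
have hs m0 : alive_mon m0 -> P ('X_[mon_map scale_mon m0] * 'X_[m0] - 'X_[mon_map gm m0]).
  move/alive_monP=> al0; rewrite mpolyX_gen {1}/mon_map -mprodXnE.
  rewrite [X in _ * X]mpolyXE_id -big_split /=.
  rewrite (eq_bigr (fun i => ('X_[scale_mon i] * 'X_i) ^+ m0 i)) => [|i _]; last first.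
    by rewrite exprMn.
  apply: ideal_cong_mon => // i /al0; exact: prime_gen_mon.
have : P ('X_[mon_map scale_mon m] * ('X_[m] - 'X_[m'])).
  have -> : 'X_[mon_map scale_mon m] * ('X_[m] - 'X_[m']) =
    ('X_[mon_map scale_mon m] * 'X_[m] - 'X_[mon_map gm m]) -
    ('X_[mon_map scale_mon m'] * 'X_[m'] - 'X_[mon_map gm m']) :> S.
    by rewrite -sE -E; ring.
  by apply: is_idealB => //; apply: hs.
case/Pmul => // /PC; have : alive_mon (mon_map scale_mon m); last by move/alive_mon_notin.
rewrite /mon_map; apply: (big_ind alive_mon); first by apply/alive_monP => i; rewrite mnm0E.
  exact: alive_monD.
move=> i _; have [mi|/(alive_monP _ al) hi] := eqVneq (m i) 0%N.
  by rewrite mi mulm0n; apply/alive_monP => j; rewrite mnm0E.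
have [_ xT yT] := pivotP Cmin hi.
have hT : alive C (T (vertex_of i)) by rewrite /alive (negbTE xT).
elim: (m i) => [|e IH]; first by rewrite mulm0n; apply/alive_monP => j; rewrite mnm0E.
rewrite mulmS; apply: alive_monD => //; rewrite /scale_mon.
case: ifP => _; first by apply: alive_monU; rewrite vertex_ofr.
case: ifP => _; first by apply: alive_monU; rewrite vertex_ofl.
by apply/alive_monP => j; rewrite mnm0E.
Qed.

(** Monomials with a dead variable lie in [P]. Among the others, those with the same generic image
    are congruent modulo [P], and the coefficients of [f] sum to zero over each such fibre because
    the image of [f] lies in the ideal generated by [C]. *)
Lemma cover_ideal_sub_prime : cover_ideal G C 1 `<=` P.
Proof.
have [P0 PD PM] := Pid => f hf.
pose s := [seq m <- msupp f | alive_mon m].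
have s0 : \sum_(m <- s) f@_m *: 'X_[mon_map gm m] = 0 :> S.
  apply/mpolyP => v; rewrite mcoeff0.
  (* Generic images have weight 0, whereas the sum agrees modulo [C] with the image of [f], whose
     monomials have positive weight. *)
  have [v0|vn0] := posnP (mwt (cover_wt C) v); last first.
    rewrite raddf_sum /= big1_seq // => m /andP [_].
    rewrite mem_filter => /andP [al _]; rewrite mcoeffZ mcoeffX.
    case: eqP => [E|_]; last exact: mulr0.
    by move: vn0; rewrite -E cover_wt_gen.
  suff /wfilPn -> : wfil (cover_wt C) 1 (\sum_(m <- s) f@_m *: 'X_[mon_map gm m] : S).
  - by [].
  - by rewrite v0.
  have -> : \sum_(m <- s) f@_m *: 'X_[mon_map gm m] =
      pert_map f - \sum_(m <- msupp f)
        f@_m *: (pert_map 'X_[m] - (alive_mon m)%:R *: 'X_[mon_map gm m]).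
    rewrite pert_map_sum -sumrB big_filter big_mkcond; apply: eq_bigr => m _.
    rewrite -scalerBr opprB addrC subrK; case: ifP => _; first by rewrite scale1r.
    by rewrite scale0r scaler0.
  apply: wfilB => //; apply: wfil_sum => m _; apply: wfilZ.
  have [al|da] := boolP (alive_mon m); first by rewrite scale1r; apply: pert_map_alive.
  by rewrite scale0r subr0; apply: pert_map_dead.
pose rep v : 'X_{1..n + n} := nth 0%MM [seq m <- s | mon_map gm m == v] 0.
have repP m : m \in s -> alive_mon (rep (mon_map gm m)) /\
    mon_map gm (rep (mon_map gm m)) = mon_map gm m.
  move=> ms; have : rep (mon_map gm m) \in [seq m' <- s | mon_map gm m' == mon_map gm m].
    apply: mem_nth; rewrite size_filter -has_count; apply/hasP; exists m => //.
  by rewrite !mem_filter => /andP [/eqP ->] /andP [-> _].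
have r0 := linear_ext_eq0 (fun v => 'X_[rep v]) s0.
rewrite [f]mpolyE (bigID alive_mon) /= -big_filter -/s.
apply: PD; last first.
  apply: is_ideal_sum => // m; rewrite negb_forall => /existsP [i].
  rewrite negb_imply => /andP [mi da]; rewrite -mul_mpolyC; apply: (PM).
  rewrite mpolyXE_id (bigD1 i) //= mulrC; apply: (PM).
  by case: (m i) mi => // e _; rewrite exprSr; apply: (PM); apply: prime_dead.
(* Subtracting the vanishing combination of representatives replaces each monomial by a difference
   inside its fibre. *)
rewrite -[X in P X]subr0; rewrite -[X in P (_ - X)]r0 -sumrB big_seq.
apply: is_ideal_sum => // m ms; have [al' E] := repP m ms.
rewrite -scalerBr -mul_mpolyC; apply: (PM); apply: prime_same_gen => //.
by move: ms; rewrite mem_filter => /andP [].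
Qed.

End Minimality.

Lemma cover_ideal_minimal : minimal_prime J (cover_ideal G C 1).
Proof.
split; [exact: (cover_ideal_prime) | exact: binomial_edge_ideal_sub |].
by move=> P Pp JP PC; apply/seteqP; split=> //; apply: cover_ideal_sub_prime.
Qed.

End CoverPrimes.

(** * Packings of initial monomials *)

Section Packings.
Local Open Scope ring_scope.
Local Open Scope classical_set_scope.

Variables (k : fieldType) (n : nat) (G : simple_graph 'I_n) (ord : 'I_n -> nat).

Notation S := {mpoly k[n + n]}.
Notation J := (binomial_edge_ideal k G).
Notation wt := (ord_wt ord).
Implicit Types (m : 'X_{1..n + n}) (f g : S) (a b u v : 'I_n) (q e t : nat).

(* [m] is divisible by a product of [q] initial monomials of elements of [J];
   "initial" means of lowest weight. *)
Definition packs q m : Prop := exists f : S,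
  [/\ ideal_pow J q f, lowform wt f m & (msize f <= (mdeg m).+1)%N].

Lemma packs0 m : packs 0 m.
Proof. by exists 'X_[m]; rewrite lowformX msizeX. Qed.

Lemma packsD q1 q2 m1 m2 : packs q1 m1 -> packs q2 m2 -> packs (q1 + q2) (m1 + m2)%MM.
Proof.
case=> f [Jf lf sf] [g [Jg lg sg]]; exists (f * g); split.
- exact: ideal_powD_mul.
- exact: lowformM.
have [->|f0] := eqVneq f 0; first by rewrite mul0r msize0.
have [->|g0] := eqVneq g 0; first by rewrite mulr0 msize0.
by rewrite msizeM // mdegD -subn1 leq_subLR; have := leq_add sf sg; rewrite addSn addnS add1n.
Qed.

Lemma packs_leq q1 q2 m1 m2 : (q2 <= q1)%N -> (m1 <= m2)%MM -> packs q1 m1 -> packs q2 m2.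
Proof.
move=> q21 m12 p1; have := packsD (packs0 (m2 - m1)%MM) p1.
rewrite submK // add0n => -[f [Jf lf sf]]; exists f; split=> //.
exact: ideal_pow_leq Jf.
Qed.

Lemma packsMn m e : packs 1 m -> packs e (m *+ e)%MM.
Proof.
move=> pm; elim: e => [|e IH]; first exact: packs0.
by rewrite mulmS -add1n; apply: packsD.
Qed.

Lemma packs_edge a b : G a b -> (ord a < ord b)%N ->
  packs 1 (U_(lshift n a) + U_(rshift n b))%MM.
Proof.
move=> ab lt; exists (edge_binomial k a b); split.
- by apply: ideal_pow1; apply: mem_edge_ideal.
- rewrite edge_binomialE /lowform addrC addKr; apply: wfilN.
  apply: wfil_leq (wfilX _ _ _); rewrite !mwtD !mwtU !ord_wtl !ord_wtr.
  by rewrite addn0 add0n.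
rewrite edge_binomialE; apply: leq_trans (msizeD_le _ _) _.
by rewrite msizeN !msizeX !mdegD !mdeg1 maxnn.
Qed.

(** The binomial of [a] and [b] need not lie in [J], but its multiple by [y_v] does, by the
    three-term relation. *)
Lemma packs_path a v b : G a v -> G v b -> (ord a < ord b)%N ->
  packs 1 (U_(lshift n a) + U_(rshift n v) + U_(rshift n b))%MM.
Proof.
move=> av vb lt; exists (yvar k v * edge_binomial k a b); split.
- rewrite edge_binomial_ytrans; have [_ ID IM] := ideal_pow_is_ideal J 1.
  by apply: (ID); apply: (IM); apply: ideal_pow1; apply: mem_edge_ideal.
- have -> : (U_(lshift n a) + U_(rshift n v) + U_(rshift n b) =
      U_(rshift n v) + (U_(lshift n a) + U_(rshift n b)))%MM.
    by apply/mnmP => i; rewrite !mnmDE addnCA addnA.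
  apply: lowformM; first exact: lowformX.
  rewrite edge_binomialE /lowform addrC addKr; apply: wfilN.
  apply: wfil_leq (wfilX _ _ _); rewrite !mwtD !mwtU !ord_wtl !ord_wtr.
  by rewrite addn0 add0n.
rewrite edge_binomialE mulrBr /yvar -!mpolyXD.
apply: leq_trans (msizeD_le _ _) _.
by rewrite msizeN !msizeX !mdegD !mdeg1 maxnn.
Qed.

Hypothesis ord_inj : injective ord.
Hypothesis pack_cover : forall m,
  exists C, cover G ord C /\ packs (mwt (cover_wt C) m) m.

(** The terms of lowest weight are removed by subtracting elements of the [t]-th power having them
    as initial terms. The size bound in [packs] keeps the degree, hence the weight, bounded, so the
    process ends at 0. *)
Lemma mem_ideal_pow_cover t f : (0 < t)%N ->
  (forall C, minset (cover G ord) C -> cover_ideal G C t f) -> ideal_pow J t f.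
Proof.
move=> t0; have [J0 JD JM] := ideal_pow_is_ideal J t.
(* [B] exceeds the weight of every monomial of degree below [msize f]. *)
pose M := \max_a ord a; pose B := (M * msize f).+1.
have wt_le m : (mwt wt m <= M * mdeg m)%N.
  rewrite mdegE big_distrr; apply: leq_sum => i _; rewrite leq_mul2r.
  apply/orP; right; case: (split_ordP i) => a ->; rewrite ?ord_wtl ?ord_wtr //.
  exact: leq_bigmax.
suff main e g : (e <= B)%N -> (msize g <= msize f)%N -> wfil wt (B - e) g ->
    (forall C, minset (cover G ord) C -> cover_ideal G C t g) -> ideal_pow J t g.
  by apply: (main B) => //; rewrite subnn; apply: wfil0n.
elim: e g => [|e IH] g eB sg hg gC.
  suff -> : g = 0 by [].
  apply/mpolyP => m; rewrite mcoeff0.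
  have [ms|/memN_msupp_eq0 //] := boolP (m \in msupp g).
  apply: (wfilPn hg); rewrite subn0 ltnS; apply: leq_trans (wt_le m) _.
  rewrite leq_mul2l; apply/orP; right; apply: ltnW; apply: leq_trans sg.
  exact: msize_mdeg_lt.
pose d := (B - e.+1)%N; rewrite -/d in hg.
pose low m := (m \in msupp g) && (mwt wt m == d).
have /choice [F hF] : forall m, exists F : S, low m ->
    [/\ ideal_pow J t F, lowform wt F m & (msize F <= (mdeg m).+1)%N].
  move=> m; have [/andP [ms /eqP md]|_] := boolP (low m); last by exists 0.
  have [C0 [C0cov C0pack]] := pack_cover m.
  have [C Cmin CC0] := minset_exists C0cov.
  have tC : (t <= mwt (cover_wt C) m)%N.
    apply: (cover_wt_low ord_inj Cmin (gC C Cmin)); first by rewrite -mcoeff_msupp.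
    by move=> m' m'g; rewrite md; apply/(wfilP _ _ _ hg).
  have CC0m : (mwt (cover_wt C) m <= mwt (cover_wt C0) m)%N.
    apply: leq_sum => i _; rewrite leq_mul2r /cover_wt; apply/orP; right.
    by have [/(fintype.subsetP CC0) ->|] := boolP (i \in C).
  have [F hF] := packs_leq (leq_trans tC CC0m) (lepm_refl m) C0pack.
  by exists F.
pose c m : k := if mwt wt m == d then g@_m else 0.
have hF' m : m \in msupp g -> c m != 0 -> low m.
  by rewrite /low /c => ->; case: ifP => //; rewrite eqxx.
pose g0 := \sum_(m <- msupp g) c m *: F m.
have Jg0 : ideal_pow J t g0.
  rewrite /g0 big_seq; apply: is_ideal_sum => // m ms.
  have [->|cm] := eqVneq (c m) 0; first by rewrite scale0r.
  by have [JF _ _] := hF m (hF' m ms cm); rewrite -mul_mpolyC; apply: (JM).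
rewrite -[g](subrK g0); apply: (JD) => //; apply: IH; first exact: ltnW.
- apply: leq_trans (msizeD_le _ _) _; rewrite geq_max sg msizeN.
  rewrite /g0 big_seq; apply: leq_trans (msize_sum _ _ _) _.
  apply/bigmax_leqP_seq => m ms _.
  have [->|cm] := eqVneq (c m) 0; first by rewrite scale0r msize0.
  have [_ _ sF] := hF m (hF' m ms cm).
  apply: leq_trans (msizeZ_le _ _) (leq_trans sF _); apply: leq_trans sg.
  exact: msize_mdeg_lt.
- have -> : (B - e = d.+1)%N by rewrite /d subnSK.
  (* Both differences are heavier than [d]: the first has lost the lowest part of [g], and each
     [F m] involved has initial monomial [m]. *)
  have -> : g - g0 = (g - wpart wt d g) - \sum_(m <- msupp g) c m *: (F m - 'X_[m]).
    rewrite -addrA -opprD; congr (_ - _); rewrite /wpart -big_split /=.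
    by apply: eq_bigr => m _; rewrite -scalerDr subrKC.
  apply: wfilB; first exact: wfil_subpart.
  rewrite big_seq; apply: wfil_sum => m ms.
  have [->|cm] := eqVneq (c m) 0; first by rewrite scale0r wfil_zero.
  have [_ lF _] := hF m (hF' m ms cm); apply: wfilZ.
  by have /andP [_ /eqP <-] := hF' m ms cm.
- move=> C Cmin; apply: (is_idealB (cover_ideal_is_ideal k G C t) (gC C Cmin)).
  exact: (ideal_pow_cover_ideal ord_inj Cmin Jg0).
Qed.

Theorem ideal_pow_symbolic_of_packing t : (0 < t)%N ->
  ideal_pow J t = symbolic_power J t.
Proof.
move=> t0; pose I := {C : {set 'I_(n + n)} | minset (cover G ord) C}.
apply: (@ideal_pow_eq_symbolic _ _ _ I (fun C => cover_ideal G (val C) t)).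
- by move=> C; apply: cover_ideal_primary.
- move=> [C Cmin]; rewrite cover_ideal_radical //.
  exact: (cover_ideal_minimal k ord_inj Cmin).
rewrite predeqE => f; split=> [Jf [C Cmin] _|hf].
  exact: (ideal_pow_cover_ideal ord_inj Cmin Jf).
by apply: mem_ideal_pow_cover => // C Cmin; apply: (hf (exist _ C Cmin)).
Qed.

End Packings.

(** * Pendant cliques graphs *)

(** [col] sends a vertex to the path vertex whose clique contains it. That columns outside [vs] are
    singletons is what makes the next join turn a whole column into a clique. *)
Lemma path_clique_joins_structure p (T : finType) (H : simple_graph T)
    (iota : 'I_p -> T) (vs : seq 'I_p) : path_clique_joins H iota vs ->
  exists col : T -> 'I_p,
    [/\ forall i, col (iota i) = i,
        forall x, col x \notin vs -> x = iota (col x)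
      & forall x y, H x y = (x != y) && (col x == col y)
          || [&& x == iota (col x), y == iota (col y) & path_adj (col x) (col y)]].
Proof.
elim=> [|{}T {}H {}iota {}vs v t _ [col [colK col_vs HE]] vvs _].
  by exists id; split=> // x y /=; rewrite !eqxx andNb.
exists (fun x => match x with inl x' => col x' | inr _ => v end); split=> //.
  by case=> [x|j]; rewrite inE ?eqxx //= negb_or => /andP [_ /col_vs {1}->].
have veq x : (x == iota v) = (col x == v).
  apply/eqP/eqP => [->|E]; first exact: colK.
  by rewrite -E; apply: col_vs; rewrite E.
case=> [x|i] [y|j]; rewrite /= ?andbF ?orbF.
- exact: HE.
- exact: veq.
- by rewrite veq eq_sym.
- by rewrite eqxx andbT.
Qed.

Lemma pendant_cliques_structure n (G : simple_graph 'I_n) : pendant_cliques G ->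
  exists p (v : nat -> 'I_n) (col : 'I_n -> nat),
    [/\ forall a, col a < p, forall i, i < p -> col (v i) = i
      & forall a b, G a b = (a != b) && (col a == col b)
          || [&& a == v (col a), b == v (col b)
               & ((col a).+1 == col b) || ((col b).+1 == col a)]].
Proof.
case=> [[|p]] [T] [H] [iota] [vs] [] // _ /path_clique_joins_structure.
case=> col [colK _ HE] [h [h' hK h'K] Hh].
exists p.+1, (fun i => h (iota (inord i))), (fun a => col (h' a)).
split=> [a|i ip|a b]; first exact: ltn_ord.
  by rewrite hK colK inordK.
have -> : G a b = H (h' a) (h' b) by rewrite -Hh !h'K.
by rewrite HE !inord_val (inj_eq (can_inj h'K)) !(can2_eq h'K hK) -val_eqE.
Qed.

(** * Ordering by columns and local description of covers *)

Section PendantCliques.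

Variables (n : nat) (G : simple_graph 'I_n) (p : nat).
Variables (v : nat -> 'I_n) (col : 'I_n -> nat).
Hypothesis col_lt : forall a, col a < p.
Hypothesis colK : forall i, i < p -> col (v i) = i.
Hypothesis adjE : forall a b, G a b = (a != b) && (col a == col b)
  || [&& a == v (col a), b == v (col b)
       & ((col a).+1 == col b) || ((col b).+1 == col a)].
Implicit Types (a b u : 'I_n) (i j : nat).

(** Columns are compared first; inside a column the path vertex comes first, then labels decide. The
    second digit is at most [n], whence the base [n.+1]. *)
Definition col_ord a : nat := col a * n.+1 + (if a == v (col a) then 0 else a.+1).

Notation ord := col_ord.

Let rank_lt a : (if a == v (col a) then 0 else a.+1) < n.+1.
Proof. by case: ifP => // _; rewrite ltnS ltn_ord. Qed.

Lemma col_ord_lt a b : col a < col b -> ord a < ord b.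
Proof.
move=> ab; rewrite /col_ord; have := rank_lt a; set r := (if _ then _ else _).
move=> r_lt; apply: leq_trans (leq_addr _ _); apply: leq_trans (_ : (col a).+1 * n.+1 <= _).
  by rewrite mulSn addnC ltn_add2r.
by rewrite leq_mul2r ab orbT.
Qed.

Lemma col_ord_col a b : ord a < ord b -> col a <= col b.
Proof. by move=> h; rewrite leqNgt; apply/negP => /col_ord_lt; rewrite ltnNge ltnW. Qed.

Lemma col_ord_inj : injective ord.
Proof.
move=> a b E; have cab : col a = col b.
  by case: (ltngtP (col a) (col b)) => // /col_ord_lt; rewrite E ltnn.
move: E; rewrite /col_ord -cab => /addnI.
case: eqP => [Ea|_]; case: eqP => [Eb|_] //; last by case=> /val_inj.
by move=> _; apply: etrans Ea (esym Eb).
Qed.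

Lemma col_ord_spine u : u != v (col u) -> ord (v (col u)) < ord u.
Proof.
by move=> uv; rewrite /col_ord colK // eqxx (negbTE uv) addn0 addnS ltnS leq_addr.
Qed.

Lemma adj_col a b : a != b -> col a = col b -> G a b.
Proof. by move=> ab cab; rewrite adjE ab cab eqxx. Qed.

Lemma adj_spine i : i.+1 < p -> G (v i) (v i.+1).
Proof.
by move=> ip; rewrite adjE !colK ?eqxx ?orbT //; apply: ltnW.
Qed.

(* The first condition meets the initial terms [x_a y_b] of the edges, the second
   one the initial terms [x_u y_(v j) y_(v (j + 1))] of the paths leaving a
   pendant clique. *)
Definition local_cover i (cx cy : 'I_n -> bool) : Prop :=
  (forall a b, ord a < ord b -> G a b -> col b < i -> cx a || cy b) /\
  (forall u, u != v (col u) -> (col u).+1 < i ->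
     [|| cx u, cy (v (col u)) | cy (v (col u).+1)]).

Definition cover_of (cx cy : 'I_n -> bool) : {set 'I_(n + n)} :=
  [set l | xy_case cx cy l].

Lemma inx_cover_of cx cy a : inx (cover_of cx cy) a = cx a.
Proof. by rewrite /inx inE xy_casel. Qed.

Lemma iny_cover_of cx cy a : iny (cover_of cx cy) a = cy a.
Proof. by rewrite /iny inE xy_caser. Qed.

(** Edges between columns join consecutive path vertices, so a connection between two columns runs
    through every [v j] in the range, both ends included. *)
Lemma connect_alive_spine C a b j : connect (alive_adj G C) a b ->
  col a < col b -> col a <= j <= col b -> alive C (v j).
Proof.
move=> /connectP [s]; elim: s a => [|c s IH] a /=; first by move=> _ ->; rewrite ltnn.
case/andP=> /and3P [ac ha hc] hs Eb ab /andP [aj jb].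
move: ac; rewrite adjE => /orP [/andP [_ /eqP cac]|/and3P [/eqP av /eqP cv cac]].
  by apply: (IH c) => //; rewrite -cac ?aj.
have hva : alive C (v (col a)) by rewrite -av.
have hvc : alive C (v (col c)) by rewrite -cv.
have [->//|ja] := eqVneq j (col a).
have [->//|jc] := eqVneq j (col c).
by apply: (IH c) => //; move/orP: cac => [] /eqP cac; lia.
Qed.

(** Suppose [x_a] and [y_b] are missing, with [b] in a later column. An edge or path condition
    forces the [y] of the path vertex one column after [a]. As these path vertices are alive, their
    [x] is then missing, and the next edge forces the next [y], up to the column of [b], where [y_b]
    itself is forced. *)
Lemma local_coverP cx cy : local_cover p cx cy -> cover G ord (cover_of cx cy).
Proof.
move=> [edge path]; apply/coverP => a b ab cab; rewrite inx_cover_of iny_cover_of.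
have aliveE c : alive (cover_of cx cy) c = ~~ (cx c && cy c).
  by rewrite /alive inx_cover_of iny_cover_of.
have ne : a != b by apply: contraTneq ab => ->; rewrite ltnn.
apply: contraT; rewrite negb_or => /andP [/negbTE ca /negbTE cb].
have := col_ord_col ab; rewrite leq_eqVlt => /orP [/eqP cab'|lt].
  by have := edge a b ab (adj_col ne cab') (col_lt b); rewrite ca cb.
have spine_edge j : j.+1 < p -> cx (v j) || cy (v j.+1).
  move=> jp; apply: edge; rewrite ?colK //; last exact: adj_spine.
  by apply: col_ord_lt; rewrite !colK // (ltnW jp).
have alv j : col a <= j <= col b -> cy (v j) -> cx (v j) = false.
  by move/(connect_alive_spine cab lt); rewrite aliveE => + cyj; rewrite cyj andbT => /negbTE.
have step j : col a <= j < col b -> cy (v j) -> cy (v j.+1).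
  move=> /andP [aj jb] cyj; have := spine_edge j (leq_ltn_trans jb (col_lt b)).
  by rewrite (alv j) // aj (ltnW jb).
have main d : col a + d.+1 <= col b -> cy (v (col a + d.+1)).
  elim: d => [|d IH] le.
    rewrite addn1 in le *; have ap : (col a).+1 < p by apply: leq_ltn_trans le _.
    have [E|ua] := eqVneq a (v (col a)); first by have := spine_edge _ ap; rewrite -E ca.
    have := path a ua ap; rewrite ca /= => /orP [cya|//].
    by apply: step => //; rewrite leqnn.
  by rewrite addnS; apply: step; [rewrite leq_addr -addnS | apply: IH; apply: ltnW; rewrite -addnS].
have cyb : cy (v (col b)).
  by have := main (col b - col a).-1; rewrite prednK ?subn_gt0 // subnKC ?(ltnW lt) //; apply.
have [E|ub] := eqVneq b (v (col b)); first by rewrite E cyb in cb.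
have := edge _ _ (col_ord_spine ub); rewrite cb (alv (col b)) //; last by rewrite leqnn (ltnW lt).
by apply=> //; apply: adj_col; rewrite ?colK // eq_sym.
Qed.

(** * Greedy matching inside a clique *)

Variable k : fieldType.
Implicit Types (m D : 'X_{1..n + n}) (us : seq 'I_n) (c : 'I_n -> nat).

Notation packs := (packs k G ord).
Notation X a := (U_(lshift n a))%MM.
Notation Y a := (U_(rshift n a))%MM.

Definition xsum us c : 'X_{1..n + n} := (\sum_(u <- us) X u *+ c u)%MM.

Definition xysum us m : 'X_{1..n + n} :=
  (\sum_(u <- us) (X u *+ m (lshift n u) + Y u *+ m (rshift n u)))%MM.

Lemma mulm_addr N (m : 'X_{1..N}) e1 e2 : (m *+ (e1 + e2) = m *+ e1 + m *+ e2)%MM.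
Proof. by apply/mnmP => l; rewrite mnmDE !mulmnE mulnDr. Qed.

Lemma xsum_split us c c1 : (forall u, c1 u <= c u) ->
  xsum us c = (xsum us (fun u => (c u - c1 u)%N) + xsum us c1)%MM.
Proof.
move=> le; rewrite /xsum -big_split /=; apply: eq_bigr => u _.
by rewrite -mulm_addr subnK.
Qed.

Lemma exists_subfunction us c e : uniq us -> e <= \sum_(u <- us) c u ->
  exists2 c1 : 'I_n -> nat, (forall u, c1 u <= c u) & \sum_(u <- us) c1 u = e.
Proof.
elim: us e => [|u us IH] e /=.
  by move=> _; rewrite big_nil leqn0 => /eqP ->; exists (fun=> 0) => //; rewrite big_nil.
case/andP=> u_us uus; rewrite big_cons => le.
have [|c1 c1c c1E] := IH (e - c u) uus; first by rewrite leq_subLR.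
exists (fun y => if y == u then minn e (c u) else c1 y).
  by move=> y; case: eqP => [->|_]; rewrite ?geq_minr.
rewrite big_cons eqxx big_seq (eq_bigr c1) => [|y yus].
  by rewrite -big_seq c1E; lia.
by case: eqP => // E; rewrite -E yus in u_us.
Qed.

Lemma packs_star us c m : (forall u, u \in us -> packs 1 (X u + m)%MM) ->
  packs (\sum_(u <- us) c u) (xsum us c + m *+ (\sum_(u <- us) c u))%MM.
Proof.
rewrite /xsum; elim: us => [|u us IH] h; first by rewrite !big_nil; apply: packs0.
rewrite !big_cons mulm_addr.
have -> : (X u *+ c u + \sum_(j <- us) X j *+ c j +
    (m *+ c u + m *+ (\sum_(j <- us) c j)) = (X u + m) *+ c u +
    (\sum_(j <- us) X j *+ c j + m *+ (\sum_(j <- us) c j)))%MM.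
  by apply/mnmP => l; rewrite !(mnmDE, mulmnE); lia.
apply: packsD; first by apply/packsMn/h; rewrite mem_head.
by apply: IH => y yus; apply: h; rewrite inE yus orbT.
Qed.

(** The weight of the clique cover formed by the [x] before [t] and the [y] after [t]. *)
Definition threshold_cost m t us : nat :=
  \sum_(a <- us) ((ord a < ord t) * m (lshift n a) + (ord t < ord a) * m (rshift n a)).

(* Scanning the clique in increasing order, match each [y_u] with a still
   unmatched earlier [x], preferring those other than [x_a]. *)
Lemma clique_packing a us m :
  pairwise (fun b b' => ord b < ord b') (a :: us) ->
  (forall b b', b \in a :: us -> b' \in a :: us -> b != b' -> G b b') ->
  exists q z c D t t',
  [/\ packs q D,
      (X a *+ m (lshift n a) + xysum us m = D + X a *+ z + xsum us c)%MM,
      q + z + \sum_(u <- us) c u = m (lshift n a) + \sum_(u <- us) m (lshift n u),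
      t \in a :: us /\ threshold_cost m t (a :: us) = q
    & t' \in a :: us /\ threshold_cost m t' us + m (lshift n a) = q + z].
Proof.
elim/last_ind: us => [|us u IH] sorted clique.
  exists 0, (m (lshift n a)), (fun=> 0), 0%MM, a, a.
  rewrite /xysum /xsum /threshold_cost big_seq1 ltnn !big_nil !mem_head; split=> //.
    exact: packs0.
  by rewrite add0m.
move: sorted; rewrite -rcons_cons pairwise_rcons => /andP [/allP lt_u sorted].
have clique' b b' : b \in a :: us -> b' \in a :: us -> b != b' -> G b b'.
  by move=> hb hc; apply: clique; rewrite -rcons_cons mem_rcons inE ?hb ?hc orbT.
(* [q] pairs are matched inside [D]; [z] and [c] count the unmatched copies of [x_a] and of the
   other [x]. The threshold [t] gives a cover of weight [q], and [t'] one containing [x_a], of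
   weight [q + z]. *)
have [q [z [c [D [t [t' [pD eD eq [ht tE] [ht' t'E]]]]]]]] := IH sorted clique'.
have neq_u b : b \in a :: us -> b == u = false.
  by move=> /lt_u; case: eqP => // ->; rewrite ltnn.
have u_us : u \notin us by apply/negP => uus; move: (neq_u u); rewrite inE uus orbT eqxx => /(_ isT).
have uniq_us : uniq us.
  by move: sorted => /= /andP [_]; apply: pairwise_uniq => y; apply: ltnn.
have edge_u b : b \in a :: us -> packs 1 (X b + Y u)%MM.
  move=> hb; apply: packs_edge; last exact: lt_u.
  by apply: clique; rewrite ?neq_u // -rcons_cons mem_rcons inE ?hb ?eqxx ?orbT.
set w := \sum_(u <- us) c u in eq; set b := m (rshift n u).
(* Of the [b] copies of [y_u], [b1] are matched inside [us] and [b2] with leftover copies of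
   [x_a]. *)
pose b1 := minn b w; pose b2 := minn (b - b1) z.
have [|c1 c1c c1E] := exists_subfunction (c := c) (e := b1) uniq_us; first exact: geq_minr.
have costE s t0 : threshold_cost m t0 (rcons s u) = threshold_cost m t0 s +
    ((ord u < ord t0) * m (lshift n u) + (ord t0 < ord u) * b).
  by rewrite /threshold_cost -cats1 big_cat big_seq1.
have costu s : {subset s <= a :: us} ->
    threshold_cost m u (rcons s u) = \sum_(y <- s) m (lshift n y).
  move=> sub; rewrite costE ltnn addn0 /threshold_cost !big_seq.
  apply: eq_bigr => y /sub /lt_u yu.
  by rewrite yu mul1n ltnNge (ltnW yu) addn0.
have costt s t0 : t0 \in a :: us ->
    threshold_cost m t0 (rcons s u) = threshold_cost m t0 s + b.
  by move=> /lt_u tu; rewrite costE tu mul1n ltnNge (ltnW tu).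
exists (q + b1 + b2), (z - b2), (fun y => if y == u then m (lshift n u) else c y - c1 y).
exists (D + (xsum us c1 + Y u *+ b1) + (X a + Y u) *+ b2 + Y u *+ (b - b1 - b2))%MM.
(* If copies of [y_u] stay unmatched, all earlier [x] are used up and the threshold moves to [u].
   For [t'], where [x_a] is paid anyway, it moves once [b] exceeds the leftover [x] of [us]. *)
exists (if b <= w + z then t else u), (if b <= w then t' else u).
have sumE (F : 'I_n -> nat) : \sum_(y <- us) (if y == u then m (lshift n u) else F y) =
    \sum_(y <- us) F y.
  rewrite !big_seq; apply: eq_bigr => y yus.
  by rewrite neq_u // inE yus orbT.
have sumB : \sum_(y <- us) (c y - c1 y) = w - b1.
  by rewrite -c1E /w sumnB.
split.
- rewrite -[q + b1 + b2]addn0; apply: packsD (packs0 _ _ _ _).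
  apply: packsD; last by apply: packsMn; apply: edge_u; rewrite mem_head.
  apply: packsD pD _; rewrite -c1E; apply: packs_star => y yus.
  by apply: edge_u; rewrite inE yus orbT.
- have -> : xysum (rcons us u) m = (xysum us m + (X u *+ m (lshift n u) + Y u *+ b))%MM.
    by rewrite /xysum -cats1 big_cat big_seq1.
  have -> : xsum (rcons us u) (fun y => if y == u then m (lshift n u) else c y - c1 y) =
      (xsum us (fun y => (c y - c1 y)%N) + X u *+ m (lshift n u))%MM.
    rewrite /xsum -cats1 big_cat big_seq1 eqxx; congr (_ + _)%MM.
    by rewrite !big_seq; apply: eq_bigr => y yus; rewrite neq_u // inE yus orbT.
  rewrite addmA eD (xsum_split us c1c).
  have -> : b = b1 + b2 + (b - b1 - b2) by rewrite /b2 /b1; lia.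
  have -> : z = (z - b2) + b2 by rewrite /b2 /b1; lia.
  have -> : b1 + b2 + (b - b1 - b2) - b1 - b2 = b - b1 - b2 by lia.
  have -> : z - b2 + b2 - b2 = z - b2 by lia.
  by apply/mnmP => l; rewrite !(mnmDE, mulmnE) !mulnDr mulnDl; lia.
- rewrite -cats1 !big_cat !big_seq1 eqxx sumE sumB /=.
  by move: eq; rewrite /b2 /b1; lia.
- split; rewrite -?rcons_cons.
    by case: ifP => _; rewrite mem_rcons inE ?eqxx // ht orbT.
  case: ifP => le; first by rewrite costt // tE /b2 /b1; lia.
  by rewrite costu // big_cons /= -eq /b2 /b1; lia.
- split; rewrite -?rcons_cons.
    by case: ifP => _; rewrite mem_rcons inE ?eqxx // ht' orbT.
  case: ifP => le; first by rewrite costt //; move: t'E; rewrite /b2 /b1; lia.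
  rewrite costu; first by rewrite addnC -eq /b2 /b1; lia.
  by move=> y ys; rewrite inE ys orbT.
Qed.

(** * Dynamic programming along the path *)

Definition column i : seq 'I_n := [seq a <- enum 'I_n | (col a == i) && (a != v i)].

Lemma mem_column i a : (a \in column i) = (col a == i) && (a != v i).
Proof. by rewrite mem_filter mem_enum andbT. Qed.

Lemma column_sorted i : i < p ->
  pairwise (fun b b' => ord b < ord b') (v i :: column i).
Proof.
move=> ip; rewrite /= ; apply/andP; split.
  apply/allP => u; rewrite mem_column => /andP [/eqP cu uv].
  by rewrite -cu in uv *; apply: col_ord_spine.
have : pairwise (fun b b' : 'I_n => (b < b')%N) (column i).
  apply: (pairwise_filter (r := fun b b' : 'I_n => (b < b')%N)).
  rewrite -(pairwise_map val ltn) val_enum_ord -sorted_pairwise ?iota_ltn_sorted //.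
  exact: ltn_trans.
apply: (sub_in_pairwise (P := mem (column i))); last by apply/allP.
move=> b b' /=; rewrite !mem_column => /andP [/eqP cb bv] /andP [/eqP cb' bv'] lt.
by rewrite /col_ord cb cb' (negbTE bv) (negbTE bv') ltn_add2l.
Qed.

Lemma column_uniq i : uniq (column i).
Proof. by rewrite filter_uniq ?enum_uniq. Qed.

Lemma column_sum i (F : 'I_n -> nat) : i < p ->
  \sum_(a | col a == i) F a = F (v i) + \sum_(a <- column i) F a.
Proof.
move=> ip; rewrite (bigD1 (v i)) ?colK //=; congr (_ + _).
by rewrite /column big_filter big_enum_cond; apply: eq_bigl.
Qed.

Definition below i m : 'X_{1..n + n} :=
  [multinom (if col (vertex_of l) < i then m l else 0) | l < n + n].

Lemma xysum_column i m l : i < p -> (X (v i) *+ m (lshift n (v i)) +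
    Y (v i) *+ m (rshift n (v i)) + xysum (column i) m)%MM l =
  if col (vertex_of l) == i then m l else 0.
Proof.
move=> ip.
have -> : (X (v i) *+ m (lshift n (v i)) + Y (v i) *+ m (rshift n (v i)) +
    xysum (column i) m)%MM l =
    \sum_(a | col a == i) (X a *+ m (lshift n a) + Y a *+ m (rshift n a))%MM l.
  by rewrite column_sum // /xysum !mnmDE mnm_sumE.
rewrite big_mkcond; case: (split_ordP l) => a ->; rewrite ?vertex_ofl ?vertex_ofr.
  rewrite (bigD1 a) //= big1 ?addn0 => [|b ba].
    by rewrite mnmDE !mulmnE !mnm1E eqxx eq_rlshift mul1n addn0.
  by rewrite mnmDE !mulmnE !mnm1E eq_lshift eq_rlshift (negbTE ba) if_same.
rewrite (bigD1 a) //= big1 ?addn0 => [|b ba].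
  by rewrite mnmDE !mulmnE !mnm1E eqxx eq_lrshift mul1n add0n.
by rewrite mnmDE !mulmnE !mnm1E eq_rshift eq_lrshift (negbTE ba) if_same.
Qed.

Lemma belowS i m : i < p -> below i.+1 m = (below i m + (X (v i) *+ m (lshift n (v i)) +
    Y (v i) *+ m (rshift n (v i)) + xysum (column i) m))%MM.
Proof.
move=> ip; apply/mnmP => l; rewrite [in RHS]mnmDE xysum_column // !mnmE ltnS leq_eqVlt.
by case: ltngtP; rewrite ?addn0.
Qed.

(* Among the copies of [y_(v i)], [r] serve the monomials
   [x_u y_(v i) y_(v (i + 1))]; the others are left to the previous column. *)
Lemma pack_column i m R L q z c D r e : i < p -> (e = 0 \/ i.+1 < p) ->
  packs (minn (R + (m (rshift n (v i)) - r)) L)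
    (below i m + Y (v i) *+ (m (rshift n (v i)) - r))%MM ->
  packs q D -> r <= m (rshift n (v i)) ->
  (X (v i) *+ m (lshift n (v i)) + xysum (column i) m =
    D + X (v i) *+ z + xsum (column i) c)%MM ->
  packs (minn (R + (m (rshift n (v i)) - r)) L + q +
    minn (z + \sum_(u <- column i) c u) (minn e (z + r)))
    (below i.+1 m + Y (v i.+1) *+ e)%MM.
Proof.
set b := m (rshift n (v i)) => ip ep pR pD rb eD.
set w := \sum_(u <- column i) c u.
(* First [z1] edge terms [x_(v i) y_(v (i + 1))] are formed, then [s] path terms
   [x_u y_(v i) y_(v (i + 1))] using the reserved copies of [y_(v i)]. *)
pose z1 := minn z e; pose s := minn w (minn r (e - z1)).
have [|c1 c1c c1E] := exists_subfunction (c := c) (e := s) (column_uniq i); first exact: geq_minl.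
have p1 : packs z1 ((X (v i) + Y (v i.+1)) *+ z1)%MM.
  case: ep => [e0|ip']; first by rewrite /z1 e0 minn0; apply: packs0.
  apply: packsMn; apply: packs_edge; first exact: adj_spine.
  by apply: col_ord_lt; rewrite !colK // ltnW.
have p2 : packs s (xsum (column i) c1 + (Y (v i) + Y (v i.+1)) *+ s)%MM.
  case: ep => [e0|ip']; first by rewrite /s e0 minnA minn0; apply: packs0.
  rewrite -c1E; apply: packs_star => u; rewrite mem_column => /andP [/eqP cu uv].
  rewrite addmA; apply: packs_path; last by apply: col_ord_lt; rewrite colK // cu.
    by apply: adj_col; rewrite ?colK.
  exact: adj_spine.
have := packsD (packsD pR pD) (packsD p1 p2).
apply: packs_leq; first by rewrite leq_add2l /s /z1; lia.
rewrite belowS // -/b; apply/mnm_lepP => l.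
have := congr1 (fun m : 'X_{1..n + n} => m l) eD.
rewrite (xsum_split (column i) c1c) !(mnmDE, mulmnE).
have f1 : X (v i) l * z1 <= X (v i) l * z by rewrite leq_mul2l geq_minl orbT.
have f2 : Y (v i) l * (b - r) + Y (v i) l * s <= Y (v i) l * b.
  rewrite -mulnDr leq_mul2l -leq_subRL ?leq_subr // subKn // /s.
  by rewrite (leq_trans (geq_minr _ _)) ?geq_minl ?orbT.
have f3 : Y (v i.+1) l * z1 + Y (v i.+1) l * s <= Y (v i.+1) l * e.
  rewrite -mulnDr leq_mul2l -leq_subRL ?geq_minr // /s.
  by rewrite (leq_trans (geq_minr _ _)) ?orbT // (leq_trans (geq_minr _ _)).
by rewrite !mulnDl; lia.
Qed.

(** With [j + 1 = i], the terms [x_(v j) y_(v i)] and [x_u y_(v j) y_(v i)] leaving the last column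
    are met without the help of [y_(v i)]. *)
Definition open_cover i (cx cy : 'I_n -> bool) : Prop :=
  forall u, (col u).+1 = i -> cx (v (col u)) /\ (u != v (col u) -> cx u || cy (v (col u))).

Definition extend_cover i (cx nx : 'I_n -> bool) a : bool :=
  if col a < i then cx a else nx a.

(** Terms joining column [i] to the previous one are met by openness of the old cover or by
    [y_(v i)]; all others lie in old columns or inside column [i]. *)
Lemma local_cover_extend i (ox oy nx ny : 'I_n -> bool) : i < p ->
  local_cover i ox oy -> open_cover i ox oy \/ ny (v i) ->
  (forall a b, col a = i -> col b = i -> ord a < ord b -> nx a || ny b) ->
  local_cover i.+1 (extend_cover i ox nx) (extend_cover i oy ny).
Proof.
move=> ip [edge path] opn new; split=> [a b ab Gab|u uv].
  rewrite ltnS leq_eqVlt /extend_cover => /orP [/eqP cb|cb]; last first.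
    by rewrite cb (leq_ltn_trans (col_ord_col ab) cb) edge.
  rewrite cb ltnn; have := col_ord_col ab; rewrite cb leq_eqVlt => /orP [/eqP ca|ca].
    by rewrite ca ltnn new.
  rewrite ca; move: Gab; rewrite adjE => /orP [/andP [_ /eqP E]|].
    by rewrite E cb ltnn in ca.
  case/and3P => /eqP av /eqP bv /orP [/eqP E|/eqP E]; last by move: ca; rewrite -cb -E; lia.
  case: opn => [opn|nv]; last by rewrite bv cb nv orbT.
  by have [] := opn a; rewrite ?E // -av => ->.
have cvu : col (v (col u)) = col u by rewrite colK.
rewrite ltnS leq_eqVlt /extend_cover cvu => /orP [/eqP cu|cu]; last first.
  by rewrite colK ?(ltn_trans cu ip) // cu (ltnW cu) path.
rewrite cu colK // ltnn -cu leqnn; case: opn => [opn|nv]; last by rewrite cu nv !orbT.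
by have [_ /(_ uv) /orP [->|->]] := opn u cu; rewrite ?orbT.
Qed.

Lemma open_cover_extend i (ox oy nx ny : 'I_n -> bool) : i < p -> nx (v i) ->
  (forall u, col u = i -> u != v i -> nx u || ny (v i)) ->
  open_cover i.+1 (extend_cover i ox nx) (extend_cover i oy ny).
Proof.
move=> ip nv nu u [cu]; rewrite /extend_cover cu colK // ltnn; split=> // uv.
exact: nu.
Qed.

Definition cost i m (cx cy : 'I_n -> bool) : nat :=
  \sum_(a | col a < i) (cx a * m (lshift n a) + cy a * m (rshift n a)).

Lemma cost_extend i m (ox oy nx ny : 'I_n -> bool) : i < p ->
  cost i.+1 m (extend_cover i ox nx) (extend_cover i oy ny) =
  cost i m ox oy + (nx (v i) * m (lshift n (v i)) + ny (v i) * m (rshift n (v i)) +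
    \sum_(a <- column i) (nx a * m (lshift n a) + ny a * m (rshift n a))).
Proof.
move=> ip; rewrite /cost (bigID (fun a => col a < i)) /=; congr (_ + _).
  apply: eq_big => [a|a /andP [_ ai]]; last by rewrite /extend_cover ai.
  by rewrite andb_idl // => /ltnW.
rewrite -(column_sum (fun a => nx a * m (lshift n a) + ny a * m (rshift n a))) //.
apply: eq_big => [a|a /andP [_ /negbTE ai]]; last by rewrite /extend_cover ai.
by rewrite ltnS -leqNgt -eqn_leq.
Qed.

(* The packing may use [e] extra copies of [y_(v i)], which the [L]-cover must
   not rely on. *)
Definition partial_packing i m : Prop := exists Rx Ry Lx Ly,
  [/\ local_cover i Rx Ry, local_cover i Lx Ly, open_cover i Lx Ly
    & forall e, e = 0 \/ i < p ->
      packs (minn (cost i m Rx Ry + e) (cost i m Lx Ly)) (below i m + Y (v i) *+ e)%MM].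

Lemma partial_packing0 m : partial_packing 0 m.
Proof.
exists xpred0, xpred0, xpred0, xpred0; split=> // e _.
rewrite {2}/cost big_pred0 // minn0; exact: packs0.
Qed.

(** Old covers are extended by three kinds of clique covers, and the cheapest results are matched by
    the packing of [pack_column]. *)
Lemma partial_packingS i m : i < p -> partial_packing i m -> partial_packing i.+1 m.
Proof.
move=> ip [Rx [Ry [Lx [Ly [covR covL openL pack]]]]].
have sorted := column_sorted ip.
have clique b b' : b \in v i :: column i -> b' \in v i :: column i -> b != b' -> G b b'.
  have colE a : a \in v i :: column i -> col a = i.
    by rewrite inE mem_column => /orP [/eqP ->|/andP [/eqP]] //; apply: colK.
  by move=> /colE cb /colE cb' bb'; apply: adj_col; rewrite ?cb.
have [q [z [c [D [t [t' [pD eD eq [ht tE] [ht' t'E]]]]]]]] := clique_packing m sorted clique.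
have le_v t0 : t0 \in v i :: column i -> ord t0 < ord (v i) = false.
  rewrite inE => /orP [/eqP ->|t0c]; first exact: ltnn.
  by move: sorted => /= /andP [/allP /(_ t0 t0c) lt _]; rewrite ltnNge (ltnW lt).
set R := cost i m Rx Ry in pack; set L := cost i m Lx Ly in pack.
set x0 := m (lshift n (v i)) in eq t'E; set y0 := m (rshift n (v i)).
set A := \sum_(u <- column i) m (lshift n u) in eq.
set w := \sum_(u <- column i) c u in eq.
have vcol u : u \in column i -> (u == v i) = false.
  by rewrite mem_column => /andP [_ /negbTE].
have v_min a : col a = i -> ord a < ord (v i) = false.
  move=> ca; have [->|av] := eqVneq a (v i); first exact: ltnn.
  apply: le_v; by rewrite inE mem_column ca eqxx av orbT.
have thr s a b : ord a < ord b -> (ord a < ord s) || (ord s < ord b).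
  by case: (ltnP (ord a) (ord s)) => //= sa /(leq_ltn_trans sa).
(* Threshold cover at [t], not necessarily open. The flag [f] adds [y_(v i)], needed if the old
   cover is not open. *)
have optM ox oy (f : bool) : local_cover i ox oy -> open_cover i ox oy \/ f ->
    exists cx cy, local_cover i.+1 cx cy /\
      cost i.+1 m cx cy = cost i m ox oy + (q + f * y0).
  move=> cov opn; exists (extend_cover i ox (fun a => ord a < ord t)),
    (extend_cover i oy (fun a => (ord t < ord a) || (a == v i) && f)); split.
    apply: local_cover_extend => // [|a b _ _ /(thr t) /orP [->|->]]; rewrite ?orbT //.
    by rewrite eqxx /=; case: opn => [|->]; [left | right; rewrite orbT].
  rewrite cost_extend // -tE /threshold_cost big_cons le_v // eqxx /= addn0 -/x0 -/y0.
  rewrite addnAC; congr (_ + (_ + _ + _)).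
  by rewrite !big_seq; apply: eq_bigr => a /vcol ->; rewrite orbF.
(* All the [x] of the column, of total weight [q + z + w]: an open extension. *)
have optA ox oy (f : bool) : local_cover i ox oy -> open_cover i ox oy \/ f ->
    exists cx cy, [/\ local_cover i.+1 cx cy, open_cover i.+1 cx cy &
      cost i.+1 m cx cy = cost i m ox oy + (q + z + w + f * y0)].
  move=> cov opn; exists (extend_cover i ox xpredT),
    (extend_cover i oy (fun a => (a == v i) && f)); split.
  - by apply: local_cover_extend => //; rewrite eqxx.
  - exact: open_cover_extend.
  rewrite cost_extend // eq eqxx mul1n -/x0 -/y0 addnAC; congr (_ + (_ + _ + _)).
  by rewrite /A !big_seq; apply: eq_bigr => a /vcol ->; rewrite mul1n addn0.
(* Both variables of [v i], and the threshold [t'] elsewhere: open, since [y_(v i)] meets the path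
   terms leaving the clique. *)
have optN ox oy : local_cover i ox oy ->
    exists cx cy, [/\ local_cover i.+1 cx cy, open_cover i.+1 cx cy &
      cost i.+1 m cx cy = cost i m ox oy + (q + z + y0)].
  move=> cov; exists (extend_cover i ox (fun a => (a == v i) || (ord a < ord t'))),
    (extend_cover i oy (fun a => (a == v i) || (ord t' < ord a))); split.
  - apply: local_cover_extend => // [|a b _ _ /(thr t') /orP [->|->]]; rewrite ?orbT //.
    by right; rewrite eqxx.
  - by apply: open_cover_extend => // [|u _ _]; rewrite eqxx ?orbT.
  rewrite cost_extend // -t'E eqxx !mul1n -/x0 -/y0 [threshold_cost _ _ _ + _]addnC addnAC.
  congr (_ + (_ + _ + _)).
  by rewrite /threshold_cost !big_seq; apply: eq_bigr => a /vcol ->.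
have [Rx' [Ry' [covR' costR']]] : exists cx cy, local_cover i.+1 cx cy /\
    cost i.+1 m cx cy = minn L (R + y0) + q.
  case: (leqP L (R + y0)) => _.
    have [cx [cy [h1 h2]]] := optM Lx Ly false covL (or_introl openL).
    by exists cx, cy; split=> //; rewrite h2 addn0.
  have [cx [cy [h1 h2]]] := optM Rx Ry true covR (or_intror isT).
  by exists cx, cy; split=> //; rewrite h2 mul1n addnCA addnC.
have [Lx' [Ly' [covL' openL' costL']]] : exists cx cy,
    [/\ local_cover i.+1 cx cy, open_cover i.+1 cx cy & cost i.+1 m cx cy =
      minn (minn L (R + y0) + (q + z + w)) (minn R L + (q + z + y0))].
  case: (leqP (minn L (R + y0) + (q + z + w))) => _.
    case: (leqP L (R + y0)) => _.
      have [cx [cy [h1 h2 h3]]] := optA Lx Ly false covL (or_introl openL).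
      by exists cx, cy; split=> //; rewrite h3 addn0.
    have [cx [cy [h1 h2 h3]]] := optA Rx Ry true covR (or_intror isT).
    by exists cx, cy; split=> //; rewrite h3 mul1n [_ + y0]addnC addnA.
  by case: (leqP R L) => _; [exact: (optN Rx Ry) | exact: (optN Lx Ly)].
exists Rx', Ry', Lx', Ly'; split=> // e ep; rewrite costR' costL'.
pose r := minn y0 (R + y0 - L).
have ry : r <= y0 by apply: geq_minl.
have := pack_column ip ep (pack (y0 - r) (or_intror ip)) pD ry eD.
apply: packs_leq (lepm_refl _); rewrite -/w -/y0.
move: ry; rewrite /r; clear; lia.
Qed.

(** After the last column, with no extra [y], the packing has the size of the cheaper of the two
    covers. *)
Lemma pack_cover m :
  exists C, cover G ord C /\ packs (mwt (cover_wt C) m) m.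
Proof.
have state i : i <= p -> partial_packing i m.
  elim: i => [_|i IH ip]; first exact: partial_packing0.
  by apply: partial_packingS => //; apply: IH; apply: ltnW.
have [Rx [Ry [Lx [Ly [covR covL _ pack]]]]] := state p (leqnn p).
have costE cx cy : mwt (cover_wt (cover_of cx cy)) m = cost p m cx cy.
  rewrite /mwt big_split_ord /= -big_split /cost /=.
  apply: eq_big => [a|a _]; first by rewrite col_lt.
  by rewrite /cover_wt !inE xy_casel xy_caser.
have belowE : below p m = m.
  by apply/mnmP => l; rewrite mnmE col_lt.
have := pack 0 (or_introl (erefl 0)); rewrite addn0 mulm0n addm0 belowE.
case: leqP => _ pm.
  by exists (cover_of Rx Ry); split; [exact: local_coverP | rewrite costE].
by exists (cover_of Lx Ly); split; [exact: local_coverP | rewrite costE].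
Qed.

End PendantCliques.

Theorem theorem3p1 (k : fieldType) (n : nat) (G : simple_graph 'I_n)
    (hG : pendant_cliques G) (t : nat) (ht : (1 <= t)%N) :
  ideal_pow (binomial_edge_ideal k G) t =
  symbolic_power (binomial_edge_ideal k G) t.
Proof.
have [p [v [col [col_lt colK adjE]]]] := pendant_cliques_structure hG.
apply: (ideal_pow_symbolic_of_packing (col_ord_inj (v := v) (col := col))) => // m.
exact: pack_cover col_lt colK adjE k m.
Qed.
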